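(* Let $f,g\colon(0,+\infty)\to(0,+\infty)$ be $C^2$ functions, both singular at the origin (that is, $f(s)\to+\infty$ and $g(s)\to+\infty$ as $s\to0^+$), such that: (a) $f(s),f'(s),g(s),g'(s)\to0$ as $s\to+\infty$; (b) $f'(s)\le0$, $g'(s)\le0$, $f''(s)\ge0$, $g''(s)\ge0$ for all $s>0$; (c) there exists $\alpha\in(0,2)$ such that $sf'(s)+\alpha f(s)\ge0$ and $sg'(s)+\alpha g(s)\le0$ for all $s>0$; (d) there exists $\bar s>0$ such that $0<g(\bar s)<f(\bar s)$. Then for every $T>0$ there exists a frozen planet orbit of period $2T$, i.e. a generalized periodic solution of period $2T$ of $$\ddot q_1=f'(|q_1|)+g'(|q_2-q_1|),\qquad \ddot q_2=f'(|q_2|)-g'(|q_2-q_1|)$$ which satisfies the boundary conditions $\dot q_1(0)=0=\dot q_2(0)$ and $q_1(T)=0=\dot q_2(T)$, and which has no other singularities.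
   Context: A frozen planet orbit of period $2T$ is obtained from a pair $(q_1,q_2)$ of continuous functions on $[0,T]$ with $q_1(t)<q_2(t)$ for all $t\in[0,T]$, with both particles on the same side of the nucleus (placed at the origin), such that $q_1(t)>0$ for $t\in[0,T)$ and $q_1(T)=0$ (so the only singularity in $[0,T]$ is the collision of $q_1$ with the origin at $t=T$), $(q_1,q_2)$ is a classical ($C^2$) solution of the system on $[0,T)$, $q_2$ is $C^1$ up to $t=T$, and $\dot q_1(0)=\dot q_2(0)=\dot q_2(T)=0$. It is extended to a generalized periodic solution of period $2T$ by reflection after the collision: $q_i(2T-t)=q_i(t)$ for $t\in[0,T]$, followed by $2T$-periodic extension; it has a unique collision per period, at $t=T$. *)

(* Defs.v *)
From Stdlib Require Import Reals.
From Coquelicot Require Import Coquelicot.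
Open Scope R_scope.

(* Meant for open sets [D], where the two-sided derivatives of the total
   function [u] depend only on the restriction of [u] to [D]. *)
Definition C2_on (D : R -> Prop) (u : R -> R) : Prop :=
  forall t, D t ->
    ex_derive u t /\ ex_derive (Derive u) t /\ continuous (Derive_n u 2) t.

(* The nucleus sits at the origin. *)
Definition singular_time (q1 q2 : R -> R) (t : R) : Prop :=
  q1 t = 0 \/ q2 t = 0 \/ q1 t = q2 t.

Record generalized_periodic_solution (f g : R -> R) (P : R) (q1 q2 : R -> R)
    : Prop := {
  gps_continuous : forall t, continuous q1 t /\ continuous q2 t;
  gps_periodic : forall t, q1 (t + P) = q1 t /\ q2 (t + P) = q2 t;
  gps_singularities_isolated : forall t0, singular_time q1 q2 t0 ->
    locally' t0 (fun t => ~ singular_time q1 q2 t);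
  gps_C2_1 : C2_on (fun t => ~ singular_time q1 q2 t) q1;
  gps_C2_2 : C2_on (fun t => ~ singular_time q1 q2 t) q2;
  gps_eq1 : forall t, ~ singular_time q1 q2 t ->
    Derive_n q1 2 t
      = Derive f (Rabs (q1 t)) + Derive g (Rabs (q2 t - q1 t));
  gps_eq2 : forall t, ~ singular_time q1 q2 t ->
    Derive_n q2 2 t
      = Derive f (Rabs (q2 t)) - Derive g (Rabs (q2 t - q1 t))
}.

(* The period of the orbit is [2 * T].  [q1] and [q2] are the orbit already
   extended to the whole line.  Reflection and periodicity make both functions
   even about [0] and about [T], so the two-sided conditions at [0] and [T]
   below are equivalent to the one-sided ones for the arc on [0, T].
   How the motion continues through the collision at [T] is prescribed by
   [fpo_reflection]. *)
Record frozen_planet_orbit (f g : R -> R) (T : R) (q1 q2 : R -> R) : Prop := {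
  fpo_solution : generalized_periodic_solution f g (2 * T) q1 q2;
  fpo_reflection : forall t, 0 <= t <= T ->
    q1 (2 * T - t) = q1 t /\ q2 (2 * T - t) = q2 t;
  fpo_order : forall t, 0 <= t <= T -> q1 t < q2 t;
  fpo_positive : forall t, 0 <= t < T -> 0 < q1 t;
  fpo_collision : q1 T = 0;
  fpo_C1_2 : forall t, 0 <= t <= T -> ex_derive q2 t /\ continuous (Derive q2) t;
  fpo_velocity1_0 : is_derive q1 0 0;
  fpo_velocity2_0 : is_derive q2 0 0;
  fpo_velocity2_T : is_derive q2 T 0;
  fpo_no_other_singularity : forall t, 0 <= t < 2 * T ->
    singular_time q1 q2 t -> t = T
}.

(* Main.v *)
Require Import Defs.
From Stdlib Require Import Reals ZArith Bool Lra Lia IndefiniteDescription.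
From Coquelicot Require Import Coquelicot.
Open Scope R_scope.

(** The orbit is found by shooting from rest.  Release the two particles at
    time [0] without velocity, the inner one at [a] and the outer one at [b];
    the two unknowns [a] and [b] have to meet two conditions, that the inner
    particle reaches the nucleus exactly at time [T] and that the outer one is
    then at rest.

    Since [f] and [g] are convex, [f'] and [g'] are nondecreasing.  Replacing
    [f' s] and [g' s] by [f' (clamp s)] and [g' (clamp s)] gives bounded
    Lipschitz forces with the same monotonicity, hence a global flow that
    depends continuously on [(a, b)] ([is_derive_flow],
    [dependence_on_data]).  Ask at first only that the inner particle be at
    a small height [eps] at time [T].  For bounded forces the signs of
    [q1 T - eps] and [q2' T] on the four sides of a large rectangle of
    initial positions are evident, and [poincare_miranda] yields a solution of
    the truncated problem ([shooting]).

    It remains to see that this solution never enters the region where the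
    forces were changed.  The estimates come from three monotone quantities:
    [q1] is concave, the separation [r = q2 - q1] is convex and starts at rest,
    hence increases, and therefore [q2] increases as well (once [q2' < 0],
    its acceleration could only decrease and [q2'] could not return to [0]).
    As the outer particle starts and ends at rest, the total repulsion it feels
    equals the total attraction it feels, which is at most [K * T] with
    [K = - f' s0], where [s0] is a lower bound for the initial positions.  This
    bounds the velocities, and since [g] is singular at [0] it forbids a small
    initial separation ([separation_0_lower]).  Finally, if the outer particle
    reached the upper truncation level [M], it would stay within a bounded
    distance of [M] during the whole motion while the inner one stays within
    a bounded distance of the nucleus; the attraction is then at least
    [- f' M] and the repulsion at most [- g' (M - c)], and [q2' T = 0] is
    impossible if [f' M < g' (M - c)] ([y_T_upper]).  Such levels [M] exist
    because of the homogeneity condition: [f / g] and [s ^ 2 * f s] are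
    nondecreasing, so [g' (s - c) <= f' s] for all large [s] would give
    [f s <= g (s - c) <= f (s - c) / rho <= (s / (s - c)) ^ 2 * f s / rho]
    with [rho > 1] ([pull_beats_push_somewhere]).

    All these bounds are uniform in [eps].  Letting [eps] tend to [0] along
    a subsequence for which the initial positions converge, concavity keeps
    [q1] away from [0] before time [T], so the limit solves the original system
    on [[0, T)], and the velocity bounds give [q1 T = 0] and
    [q2 t - q2 T = O((T - t) ^ 2)] ([arc_exists]).  The arc is then extended by
    composing it with the triangle wave [fold]
    ([extension_is_frozen_planet_orbit]). *)

(** * Derivative estimates *)

Lemma mean_value_ge (u v : R -> R) (m a b : R) :
  a <= b -> (forall t, a <= t <= b -> is_derive u t (v t)) ->
  (forall t, a <= t <= b -> m <= v t) -> m * (b - a) <= u b - u a.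
Proof.
  intros Hab Hd Hm.
  destruct (MVT_gen u a b v) as [c [Hc ->]].
  - rewrite Rmin_left, Rmax_right by lra. intros; apply Hd; lra.
  - rewrite Rmin_left, Rmax_right by lra. intros x Hx.
    apply continuity_pt_filterlim, @ex_derive_continuous.
    eexists; apply Hd; lra.
  - rewrite Rmin_left, Rmax_right in Hc by lra.
    apply Rmult_le_compat_r; [lra|]. now apply Hm.
Qed.

Lemma mean_value_le (u v : R -> R) (m a b : R) :
  a <= b -> (forall t, a <= t <= b -> is_derive u t (v t)) ->
  (forall t, a <= t <= b -> v t <= m) -> u b - u a <= m * (b - a).
Proof.
  intros Hab Hd Hm.
  assert (H : - m * (b - a) <= - u b - - u a).
  { apply (mean_value_ge (fun t => - u t) (fun t => - v t)); trivial.
    - intros; now apply (is_derive_opp u), Hd.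
    - intros t Ht; specialize (Hm t Ht); lra. }
  lra.
Qed.

Lemma derivative_comparison (u v w w' : R -> R) (a b : R) :
  a <= b -> (forall t, a <= t <= b -> is_derive u t (v t)) ->
  (forall t, a <= t <= b -> is_derive w t (w' t)) ->
  (forall t, a <= t <= b -> v t <= w' t) -> u b - u a <= w b - w a.
Proof.
  intros Hab Hu Hw Hle.
  pose proof (mean_value_ge (fun t => w t - u t) (fun t => w' t - v t) 0 a b Hab) as H.
  assert (0 * (b - a) <= w b - u b - (w a - u a)); [apply H|lra].
  - intros t Ht. apply (is_derive_minus w u t (w' t) (v t)); auto.
  - intros t Ht. specialize (Hle t Ht). lra.
Qed.

Lemma is_derive_continuous (u : R -> R) (t l : R) :
  is_derive u t l -> continuous u t.
Proof. intros H; apply @ex_derive_continuous; now exists l. Qed.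

Lemma motion_from_rest_ge (z v w : R -> R) (m t : R) :
  0 <= t -> (forall s, 0 <= s <= t -> is_derive z s (v s)) ->
  (forall s, 0 <= s <= t -> is_derive v s (w s)) -> v 0 = 0 ->
  (forall s, 0 <= s <= t -> m <= w s) ->
  m * t <= v t /\ z 0 + m * t ^ 2 / 2 <= z t.
Proof.
  intros Ht Hz Hv Hv0 Hw.
  assert (Hvs : forall s, 0 <= s <= t -> m * s <= v s).
  { intros s Hs. pose proof (mean_value_ge v w m 0 s (proj1 Hs)) as H.
    rewrite Hv0, !Rminus_0_r in H.
    apply H; intros; [apply Hv|apply Hw]; lra. }
  split; [apply Hvs; lra|].
  assert (H : m * t ^ 2 / 2 - m * 0 ^ 2 / 2 <= z t - z 0).
  { apply (derivative_comparison (fun s => m * s ^ 2 / 2) (fun s => m * s) z v); auto.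
    intros s _. auto_derive; [trivial|field]. }
  simpl in *. lra.
Qed.

Lemma motion_from_rest_le (z v w : R -> R) (m t : R) :
  0 <= t -> (forall s, 0 <= s <= t -> is_derive z s (v s)) ->
  (forall s, 0 <= s <= t -> is_derive v s (w s)) -> v 0 = 0 ->
  (forall s, 0 <= s <= t -> w s <= m) ->
  v t <= m * t /\ z t <= z 0 + m * t ^ 2 / 2.
Proof.
  intros Ht Hz Hv Hv0 Hw.
  destruct (motion_from_rest_ge (fun s => - z s) (fun s => - v s) (fun s => - w s) (- m) t Ht) as [H1 H2].
  - intros s Hs. now apply (is_derive_opp z), Hz.
  - intros s Hs. now apply (is_derive_opp v), Hv.
  - rewrite Hv0; ring.
  - intros s Hs. specialize (Hw s Hs); lra.
  - split; [lra|]. replace (- m * t ^ 2 / 2) with (- (m * t ^ 2 / 2)) in H2 by field. lra.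
Qed.

(** * Convergent subsequences *)

Lemma bounded_subsequence (u : nat -> R) (a b : R) :
  (forall n, a <= u n <= b) ->
  exists (phi : nat -> nat) (l : R),
    (forall n, (n <= phi n)%nat) /\ is_lim_seq (fun n => u (phi n)) l.
Proof.
  intros Hu.
  destruct (Bolzano_Weierstrass u (fun x => a <= x <= b) (compact_P3 a b) Hu)
    as [l Hl].
  assert (H : forall n, exists p, (n <= p)%nat /\ Rabs (u p - l) < / (INR n + 1)).
  { intros n.
    assert (Hn : 0 < / (INR n + 1)).
    { apply Rinv_0_lt_compat. pose proof (pos_INR n); lra. }
    destruct (Hl (disc l (mkposreal _ Hn)) n) as [p [Hp1 Hp2]].
    - exists (mkposreal _ Hn). intros x Hx; exact Hx.
    - exists p; split; [exact Hp1|exact Hp2]. }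
  apply functional_choice in H. destruct H as [phi Hphi].
  exists phi, l. split; [apply Hphi|].
  apply is_lim_seq_spec. intros eps.
  destruct (INR_unbounded (/ eps)) as [N HN].
  exists N. intros n Hn.
  eapply Rlt_le_trans; [apply Hphi|].
  rewrite <- (Rinv_inv eps).
  apply Rinv_le_contravar; [apply Rinv_0_lt_compat, eps|].
  apply le_INR in Hn. lra.
Qed.

(** Extractions are only required to satisfy [n <= phi n]; this suffices to
    preserve limits and is easier to obtain than strict monotonicity. *)
Lemma is_lim_seq_subseq_ge (u : nat -> R) (phi : nat -> nat) (l : Rbar) :
  (forall n, (n <= phi n)%nat) -> is_lim_seq u l ->
  is_lim_seq (fun n => u (phi n)) l.
Proof.
  intros Hphi Hu. apply (is_lim_seq_subseq u l phi); [|exact Hu].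
  intros P [N HN]. exists N. intros n Hn. apply HN. specialize (Hphi n); lia.
Qed.

(** * The Poincare-Miranda theorem in the plane *)

(** Colour a vertex with first sign [a] and second sign [b] by 1 if [a] holds, by
    2 if only [b] holds, and by 3 otherwise, as in Sperner's lemma.  A door is
    an edge with colours 1 and 2. *)
Definition door (a b a' b' : bool) : bool :=
  (a && negb a' && b') || (a' && negb a && b).

(** If [a] or [b] is constant on the corners of a cell, its boundary has an even
    number of doors.  If this held for every cell, the number of doors in a row
    of horizontal edges would have the same parity for all rows, because the
    left and right sides of the square have no doors.  But the bottom row has an
    odd number of doors and the top row none. *)
Lemma parity_of_doors (a b : nat -> nat -> bool) (n : nat) :
  (forall j, (j <= n)%nat -> a 0%nat j = true) ->
  (forall j, (j <= n)%nat -> a n j = false) ->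
  (forall i, (i <= n)%nat -> b i 0%nat = true) ->
  (forall i, (i <= n)%nat -> b i n = false) ->
  exists i j, (i < n)%nat /\ (j < n)%nat /\
   ~ (a i j = a (S i) j /\ a i j = a i (S j) /\ a i j = a (S i) (S j)) /\
   ~ (b i j = b (S i) j /\ b i j = b i (S j) /\ b i j = b (S i) (S j)).
Proof.
  intros Hl Hr Hb Ht.
  set (h := fun i j => door (a i j) (b i j) (a (S i) j) (b (S i) j)).
  set (v := fun i j => door (a i j) (b i j) (a i (S j)) (b i (S j))).
  set (row := fix row m j := match m with O => false
                 | S m => xorb (row m j) (h m j) end).
  destruct (Classical_Prop.classic (exists i j, (i < n)%nat /\ (j < n)%nat /\
   ~ (a i j = a (S i) j /\ a i j = a i (S j) /\ a i j = a (S i) (S j)) /\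
   ~ (b i j = b (S i) j /\ b i j = b i (S j) /\ b i j = b (S i) (S j))))
    as [H|H]; [exact H|exfalso].
  (* A cell on which [a] or [b] is constant has evenly many doors. *)
  assert (Hcell : forall i j, (i < n)%nat -> (j < n)%nat ->
    xorb (h i j) (h i (S j)) = xorb (v i j) (v (S i) j)).
  { intros i j Hi Hj.
    destruct (Classical_Prop.classic
     (a i j = a (S i) j /\ a i j = a i (S j) /\ a i j = a (S i) (S j)))
      as [[E1 [E2 E3]]|Ha].
    - unfold h, v, door. rewrite <- E1, <- E2, <- E3.
      now destruct (a i j), (b i j), (b (S i) j), (b i (S j)), (b (S i) (S j)).
    - destruct (Classical_Prop.classic
       (b i j = b (S i) j /\ b i j = b i (S j) /\ b i j = b (S i) (S j)))
        as [[E1 [E2 E3]]|Hb'].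
      + unfold h, v, door. rewrite <- E1, <- E2, <- E3.
        now destruct (b i j), (a i j), (a (S i) j), (a i (S j)), (a (S i) (S j)).
      + exfalso; apply H; exists i, j; auto. }
  assert (Hstep : forall j, (j < n)%nat -> row n j = row n (S j)).
  { intros j Hj.
    assert (Hm : forall m, (m <= n)%nat ->
      xorb (row m j) (row m (S j)) = xorb (v 0%nat j) (v m j)).
    { induction m as [|m IH]; intros Hm; simpl.
      - now rewrite xorb_nilpotent.
      - specialize (IH ltac:(lia)). specialize (Hcell m j ltac:(lia) Hj).
        destruct (row m j), (row m (S j)), (h m j), (h m (S j)), (v 0%nat j),
          (v m j), (v (S m) j); simpl in *; congruence. }
    specialize (Hm n (le_n n)).
    unfold v, door in Hm.
    rewrite !Hl, !Hr in Hm by lia. simpl in Hm.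
    now apply xorb_eq. }
  assert (Htop : forall m, (m <= n)%nat -> row m n = false).
  { induction m as [|m IH]; intros Hm; simpl; [reflexivity|].
    rewrite IH by lia. unfold h, door. rewrite !Ht by lia.
    now destruct (a m n), (a (S m) n). }
  (* On the bottom side the doors are the changes of [a]. *)
  assert (Hbot : forall m, (m <= n)%nat -> row m 0%nat = negb (a m 0%nat)).
  { induction m as [|m IH]; intros Hm; simpl.
    - now rewrite Hl by lia.
    - rewrite IH by lia. unfold h, door. rewrite !Hb by lia.
      now destruct (a m 0%nat), (a (S m) 0%nat). }
  assert (Hall : forall j, (j <= n)%nat -> row n j = row n 0%nat).
  { induction j as [|j IH]; intros Hj; [reflexivity|].
    rewrite <- Hstep by lia. apply IH; lia. }
  specialize (Hall n (le_n n)).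
  rewrite Htop, Hbot, Hr in Hall by lia. discriminate.
Qed.

(** A nonzero value at the limit would fix the sign of [u] on all small cells
    close to it. *)
Lemma sign_change_at_limit (u : R -> R -> R) (x y d : R)
  (X Y : nat -> R) :
  0 <= d -> continuity_2d_pt u x y -> is_lim_seq X x -> is_lim_seq Y y ->
  (forall n, exists p q p' q',
      X n <= p <= X n + d / (INR n + 1) /\ Y n <= q <= Y n + d / (INR n + 1) /\
      X n <= p' <= X n + d / (INR n + 1) /\ Y n <= q' <= Y n + d / (INR n + 1) /\
      u p q < 0 /\ 0 <= u p' q') -> u x y = 0.
Proof.
  intros Hd Hu HX HY Hs.
  apply Rle_antisym; apply Rnot_lt_le; intros Hlt;
  (assert (He : 0 < Rabs (u x y)) by (apply Rabs_pos_lt; lra));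
  destruct (Hu (mkposreal _ He)) as [del Hdel]; simpl in Hdel;
  pose proof (cond_pos del) as Hpos;
  (assert (HD : is_lim_seq (fun n => d / (INR n + 1)) 0) by
   (replace (Finite 0) with (Rbar_mult d (Finite 0)) by (simpl; f_equal; ring);
    apply is_lim_seq_scal_l; apply (is_lim_seq_inv _ p_infty);
    [ apply (is_lim_seq_plus _ _ p_infty 1);
      [apply is_lim_seq_INR | apply is_lim_seq_const | reflexivity ] | easy ]));
  (assert (He2 : 0 < del / 2) by lra);
  apply is_lim_seq_spec in HX; apply is_lim_seq_spec in HY;
  apply is_lim_seq_spec in HD;
  destruct (HX (mkposreal _ He2)) as [N1 H1];
  destruct (HY (mkposreal _ He2)) as [N2 H2];
  destruct (HD (mkposreal _ He2)) as [N3 H3]; simpl in H1, H2, H3;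
  pose (n := (N1 + N2 + N3)%nat);
  specialize (H1 n ltac:(lia)); specialize (H2 n ltac:(lia));
  specialize (H3 n ltac:(lia));
  apply Rabs_def2 in H1; apply Rabs_def2 in H2; apply Rabs_def2 in H3;
  destruct (Hs n) as [p [q [p' [q' [Hp [Hq [Hp' [Hq' [Hn Hnn]]]]]]]]].
  - specialize (Hdel p q ltac:(apply Rabs_def1; lra) ltac:(apply Rabs_def1; lra)).
    rewrite (Rabs_right (u x y)) in Hdel by lra.
    apply Rabs_def2 in Hdel. lra.
  - specialize (Hdel p' q' ltac:(apply Rabs_def1; lra) ltac:(apply Rabs_def1; lra)).
    rewrite (Rabs_left (u x y)) in Hdel by lra.
    apply Rabs_def2 in Hdel. lra.
Qed.

(** On the grid of mesh [1 / (n + 1)] of the rectangle some cell sees both [u] and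
    [v] change sign, by [parity_of_doors]; a limit point of these cells is a
    common zero. *)
Theorem poincare_miranda (u v : R -> R -> R) (a1 b1 a2 b2 : R) :
  a1 <= b1 -> a2 <= b2 ->
  (forall x y, continuity_2d_pt u x y) -> (forall x y, continuity_2d_pt v x y) ->
  (forall y, a2 <= y <= b2 -> u a1 y < 0) ->
  (forall y, a2 <= y <= b2 -> 0 <= u b1 y) ->
  (forall x, a1 <= x <= b1 -> v x b2 < 0) ->
  (forall x, a1 <= x <= b1 -> 0 <= v x a2) ->
  exists x y, a1 <= x <= b1 /\ a2 <= y <= b2 /\ u x y = 0 /\ v x y = 0.
Proof.
  intros H1 H2 Cu Cv Hl Hr Ht Hb.
  pose (gx := fun (n i : nat) => a1 + INR i * ((b1 - a1) / (INR n + 1))).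
  pose (gy := fun (n j : nat) => a2 + INR j * ((b2 - a2) / (INR n + 1))).
  pose (neg := fun r => if Rlt_dec r 0 then true else false).
  pose (d := (b1 - a1) + (b2 - a2)).
  assert (Hgrid : forall lo hi n i, lo <= hi -> (i <= S n)%nat ->
     lo <= lo + INR i * ((hi - lo) / (INR n + 1)) <= hi).
  { intros lo hi n i Hh Hi. apply le_INR in Hi. rewrite S_INR in Hi.
    pose proof (pos_INR i). pose proof (pos_INR n).
    assert (0 <= (hi - lo) / (INR n + 1)) by (apply Rdiv_le_0_compat; lra).
    split; [nra|].
    apply Rle_trans with (lo + (INR n + 1) * ((hi - lo) / (INR n + 1))); [nra|].
    right; field; lra. }
  assert (Hend : forall lo hi n,
     lo + INR (S n) * ((hi - lo) / (INR n + 1)) = hi).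
  { intros. rewrite S_INR. field. pose proof (pos_INR n); lra. }
  assert (H : forall n, exists p : nat * nat, (fst p <= n)%nat /\ (snd p <= n)%nat /\
    let '(i, j) := p in
    ~ (neg (u (gx n i) (gy n j)) = neg (u (gx n (S i)) (gy n j)) /\
       neg (u (gx n i) (gy n j)) = neg (u (gx n i) (gy n (S j))) /\
       neg (u (gx n i) (gy n j)) = neg (u (gx n (S i)) (gy n (S j)))) /\
    ~ (neg (v (gx n i) (gy n j)) = neg (v (gx n (S i)) (gy n j)) /\
       neg (v (gx n i) (gy n j)) = neg (v (gx n i) (gy n (S j))) /\
       neg (v (gx n i) (gy n j)) = neg (v (gx n (S i)) (gy n (S j))))).
  { intros n.
    (* The discrete statement wants the bottom side positive and the top side
       negative, hence the negation for [v]. *)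
    destruct (parity_of_doors (fun i j => neg (u (gx n i) (gy n j)))
       (fun i j => negb (neg (v (gx n i) (gy n j)))) (S n)) as [i [j [Hi [Hj [HA HB]]]]].
    - intros j Hj. unfold neg, gx. simpl INR. rewrite Rmult_0_l, Rplus_0_r.
      specialize (Hl _ (Hgrid _ _ n j H2 Hj)). fold (gy n j) in Hl.
      destruct (Rlt_dec _ 0); [reflexivity|lra].
    - intros j Hj. unfold neg, gx. rewrite Hend.
      specialize (Hr _ (Hgrid _ _ n j H2 Hj)). fold (gy n j) in Hr.
      destruct (Rlt_dec _ 0); [lra|reflexivity].
    - intros i Hi. unfold neg, gy. simpl INR. rewrite Rmult_0_l, Rplus_0_r.
      specialize (Hb _ (Hgrid _ _ n i H1 Hi)). fold (gx n i) in Hb.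
      destruct (Rlt_dec _ 0); [lra|reflexivity].
    - intros i Hi. unfold neg, gy. rewrite Hend.
      specialize (Ht _ (Hgrid _ _ n i H1 Hi)). fold (gx n i) in Ht.
      destruct (Rlt_dec _ 0); [reflexivity|lra].
    - exists (i, j). simpl fst; simpl snd.
      split; [lia|]. split; [lia|]. split; [exact HA|].
      intros [E1 [E2 E3]]. apply HB. rewrite <- E1, <- E2, <- E3. auto. }
  apply functional_choice in H. destruct H as [p Hp].
  pose (X := fun n => gx n (fst (p n))). pose (Y := fun n => gy n (snd (p n))).
  assert (HX : forall n, a1 <= X n <= b1).
  { intros n; apply Hgrid; [exact H1|]. destruct (Hp n); lia. }
  assert (HY : forall n, a2 <= Y n <= b2).
  { intros n; apply Hgrid; [exact H2|]. destruct (Hp n) as [_ [? _]]; lia. }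
  destruct (bounded_subsequence X a1 b1 HX) as [phi [x [Hphi Lx]]].
  destruct (bounded_subsequence (fun n => Y (phi n)) a2 b2 (fun n => HY (phi n)))
    as [psi [y [Hpsi Ly]]].
  apply is_lim_seq_subseq_ge with (phi := psi) in Lx; [|exact Hpsi].
  assert (Hsub : forall n, (n <= phi (psi n))%nat).
  { intros n; specialize (Hphi (psi n)); specialize (Hpsi n); lia. }
  assert (Hd0 : 0 <= d) by (unfold d; lra).
  assert (Hcorner : forall n, 
    0 <= (b1 - a1) / (INR (phi (psi n)) + 1) <= d / (INR n + 1) /\
    0 <= (b2 - a2) / (INR (phi (psi n)) + 1) <= d / (INR n + 1)).
  { intros n. specialize (Hsub n). apply le_INR in Hsub. pose proof (pos_INR n).
    assert (forall c, 0 <= c <= d ->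
      0 <= c / (INR (phi (psi n)) + 1) <= d / (INR n + 1)).
    { intros c Hc. split; [apply Rdiv_le_0_compat; lra|].
      unfold Rdiv. apply Rmult_le_compat; try lra.
      - left; apply Rinv_0_lt_compat; lra.
      - apply Rinv_le_contravar; lra. }
    unfold d in *; split; apply H0; lra. }
  assert (Hsign : forall w : R -> R -> R,
    (forall n, let '(i, j) := p n in
    ~ (neg (w (gx n i) (gy n j)) = neg (w (gx n (S i)) (gy n j)) /\
       neg (w (gx n i) (gy n j)) = neg (w (gx n i) (gy n (S j))) /\
       neg (w (gx n i) (gy n j)) = neg (w (gx n (S i)) (gy n (S j))))) ->
    (forall x y, continuity_2d_pt w x y) -> w x y = 0).
  { intros w Hw Cw.
    apply (sign_change_at_limit w x y d _ _ Hd0 (Cw x y) Lx Ly).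
    intros n. specialize (Hw (phi (psi n))). specialize (Hcorner n).
    unfold X, Y. destruct (p (phi (psi n))) as [i j]. simpl fst; simpl snd.
    set (m := phi (psi n)) in *.
    assert (EX : gx m (S i) = gx m i + (b1 - a1) / (INR m + 1))
      by (unfold gx; rewrite S_INR; ring).
    assert (EY : gy m (S j) = gy m j + (b2 - a2) / (INR m + 1))
      by (unfold gy; rewrite S_INR; ring).
    assert (Hneg : exists i' j', (i' = i \/ i' = S i) /\ (j' = j \/ j' = S j) /\
       w (gx m i') (gy m j') < 0).
    { apply Classical_Prop.NNPP. intros HN. apply Hw. unfold neg.
      assert (HN' : forall i' j', (i' = i \/ i' = S i) -> (j' = j \/ j' = S j) ->
         ~ w (gx m i') (gy m j') < 0) by (intros i' j' ? ? ?; apply HN; eauto).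
      repeat (destruct (Rlt_dec _ 0); [exfalso; eapply HN'; [| |eassumption]; auto|]). auto. }
    assert (Hnonneg : exists i' j', (i' = i \/ i' = S i) /\ (j' = j \/ j' = S j) /\
       0 <= w (gx m i') (gy m j')).
    { apply Classical_Prop.NNPP. intros HN. apply Hw. unfold neg.
      assert (HN' : forall i' j', (i' = i \/ i' = S i) -> (j' = j \/ j' = S j) ->
         ~ ~ w (gx m i') (gy m j') < 0)
        by (intros i' j' ? ? ?; apply HN; exists i', j'; repeat split; auto; lra).
      repeat (destruct (Rlt_dec _ 0); [|exfalso; eapply HN'; [| |eassumption]; auto]). auto. }
    destruct Hneg as [i1 [j1 [Hi1 [Hj1 Hs1]]]].
    destruct Hnonneg as [i2 [j2 [Hi2 [Hj2 Hs2]]]].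
    exists (gx m i1), (gy m j1), (gx m i2), (gy m j2).
    repeat split; trivial;
    repeat match goal with H : _ \/ _ |- _ => destruct H; subst end; lra. }
  exists x, y. repeat split.
  - exact (is_lim_seq_le _ _ (Finite a1) (Finite x) (fun n => proj1 (HX (phi (psi n)))) (is_lim_seq_const a1) Lx).
  - exact (is_lim_seq_le _ _ (Finite x) (Finite b1) (fun n => proj2 (HX (phi (psi n)))) Lx (is_lim_seq_const b1)).
  - exact (is_lim_seq_le _ _ (Finite a2) (Finite y) (fun n => proj1 (HY (phi (psi n)))) (is_lim_seq_const a2) Ly).
  - exact (is_lim_seq_le _ _ (Finite y) (Finite b2) (fun n => proj2 (HY (phi (psi n)))) Ly (is_lim_seq_const b2)).
  - apply Hsign; [|exact Cu]. intros n. specialize (Hp n).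
    destruct (p n) as [i j]. tauto.
  - apply Hsign; [|exact Cv]. intros n. specialize (Hp n).
    destruct (p n) as [i j]. tauto.
Qed.

(** * Second-order systems with a Lipschitz force *)

Definition primitive (h : R -> R) (t : R) : R := RInt h 0 t.

Lemma is_derive_primitive (h : R -> R) :
  (forall t, continuous h t) -> forall t, is_derive (primitive h) t (h t).
Proof.
  intros Hh t. apply (is_derive_RInt h (primitive h) 0); [|apply Hh].
  apply filter_forall. intros x. apply @RInt_correct, @ex_RInt_continuous.
  intros; apply Hh.
Qed.

Lemma primitive_0 (h : R -> R) : primitive h 0 = 0.
Proof. unfold primitive. now rewrite RInt_point. Qed.

Lemma primitive_minus (h k : R -> R) (t : R) :
  (forall s, continuous h s) -> (forall s, continuous k s) ->
  primitive (fun s => h s - k s) t = primitive h t - primitive k t.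
Proof.
  intros Hh Hk. unfold primitive.
  apply (RInt_minus h k); apply @ex_RInt_continuous; auto.
Qed.

(** Integration from [0] gains a factor [1 / lam] in the norm with weight
    [exp (lam * Rabs t)].  The weight makes the Picard operator a contraction on
    the whole line, without restriction to short time intervals. *)
Lemma primitive_exp_bound (h : R -> R) (C lam t : R) :
  0 < lam -> (forall s, continuous h s) ->
  (forall s, Rabs (h s) <= C * exp (lam * Rabs s)) ->
  Rabs (primitive h t) <= C / lam * exp (lam * Rabs t).
Proof.
  intros Hlam Hc Hb.
  assert (HC : 0 <= C).
  { specialize (Hb 0). rewrite Rabs_R0, Rmult_0_r, exp_0 in Hb.
    pose proof (Rabs_pos (h 0)); lra. }
  assert (0 <= C / lam) by (apply Rdiv_le_0_compat; lra).
  pose proof (is_derive_primitive h Hc) as Hd.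
  assert (Hd' : forall s, is_derive (fun s => - primitive h s) s (- h s))
    by (intros s; apply (is_derive_opp (primitive h)), Hd).
  destruct (Rle_dec 0 t) as [Ht|Ht].
  - assert (Hw : forall s, is_derive (fun s => C / lam * exp (lam * s)) s
      (C * exp (lam * s))) by (intros s; auto_derive; [trivial|field; lra]).
    assert (Hb' : forall s, 0 <= s <= t -> - (C * exp (lam * s)) <= h s <= C * exp (lam * s)).
    { intros s Hs. specialize (Hb s). rewrite (Rabs_right s) in Hb by lra.
      now apply Rabs_le_between. }
    rewrite (Rabs_right t) by lra.
    pose proof (derivative_comparison _ _ _ _ 0 t Ht (fun s _ => Hd s) (fun s _ => Hw s)
      (fun s Hs => proj2 (Hb' s Hs))) as H1.
    assert (H2 := derivative_comparison _ _ _ _ 0 t Ht (fun s _ => Hd' s) (fun s _ => Hw s)).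
    simpl in H2. rewrite primitive_0, Rmult_0_r, exp_0 in *.
    apply Rabs_le; split; [|lra].
    assert (forall s, 0 <= s <= t -> - h s <= C * exp (lam * s))
      by (intros s Hs; specialize (Hb' s Hs); lra).
    specialize (H2 H0). lra.
  - assert (Hw : forall s, is_derive (fun s => - (C / lam) * exp (- lam * s)) s
      (C * exp (- lam * s))) by (intros s; auto_derive; [trivial|field; lra]).
    assert (Hb' : forall s, t <= s <= 0 -> - (C * exp (- lam * s)) <= h s <= C * exp (- lam * s)).
    { intros s Hs. specialize (Hb s). rewrite (Rabs_left1 s) in Hb by lra.
      replace (lam * - s) with (- lam * s) in Hb by ring.
      now apply Rabs_le_between. }
    rewrite (Rabs_left t) by lra. replace (lam * - t) with (- lam * t) by ring.
    assert (Ht' : t <= 0) by lra.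
    pose proof (derivative_comparison _ _ _ _ t 0 Ht' (fun s _ => Hd s) (fun s _ => Hw s)
      (fun s Hs => proj2 (Hb' s Hs))) as H1.
    assert (H2 := derivative_comparison _ _ _ _ t 0 Ht' (fun s _ => Hd' s) (fun s _ => Hw s)).
    simpl in H2. rewrite primitive_0, Rmult_0_r, exp_0 in *.
    assert (forall s, t <= s <= 0 -> - h s <= C * exp (- lam * s))
      by (intros s Hs; specialize (Hb' s Hs); lra).
    specialize (H2 H0).
    apply Rabs_le; split; lra.
Qed.

Section LipschitzForce.

(* The two coordinates are indexed by [bool], so that each estimate is proved once
   for both; [A i x y] is the acceleration of coordinate [i] when coordinate [true]
   is at [x] and coordinate [false] at [y]. *)
Variable A : bool -> R -> R -> R.
Variable L : R.
Hypothesis A_lipschitz : forall i x y x' y',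
  Rabs (A i x y - A i x' y') <= L * (Rabs (x - x') + Rabs (y - y')).

Definition along (z : bool -> R -> R) (i : bool) (t : R) : R :=
  A i (z true t) (z false t).

Lemma lipschitz_constant_nonneg : 0 <= L.
Proof.
  pose proof (A_lipschitz true 1 0 0 0) as H.
  pose proof (Rabs_pos (A true 1 0 - A true 0 0)).
  replace (1 - 0) with 1 in H by ring.
  rewrite Rminus_diag, Rabs_R0, Rabs_R1 in H. lra.
Qed.

Lemma along_continuous (z : bool -> R -> R) :
  (forall i t, continuous (z i) t) -> forall i t, continuous (along z i) t.
Proof.
  intros Hz i t. apply filterlim_locally. intros eps.
  pose proof lipschitz_constant_nonneg as HL.
  assert (He : 0 < eps / (2 * L + 1)).
  { apply Rdiv_lt_0_compat; [apply eps|lra]. }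
  assert (H : forall j, locally t (fun s => Rabs (z j s - z j t) < eps / (2 * L + 1))).
  { intros j. specialize (Hz j t). apply filterlim_locally with (eps := mkposreal _ He) in Hz.
    exact Hz. }
  generalize (filter_and _ _ (H true) (H false)). apply filter_imp.
  intros s [H1 H2]. unfold ball; simpl; unfold AbsRing_ball, abs, minus, plus, opp; simpl.
  unfold along.
  eapply Rle_lt_trans; [apply A_lipschitz|].
  apply Rle_lt_trans with (L * (2 * (eps / (2 * L + 1)))).
  - apply Rmult_le_compat_l; lra.
  - apply Rlt_le_trans with ((2 * L + 1) * (eps / (2 * L + 1))); [nra|].
    right; field; lra.
Qed.

Section Picard.

Variable c : bool -> R.

(** Two integrations encode [z'' = A z] with [z 0 = c] and zero initial velocity. *)
Definition picard_step (z : bool -> R -> R) (i : bool) (t : R) : R :=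
  c i + primitive (primitive (along z i)) t.

Fixpoint picard (n : nat) : bool -> R -> R :=
  match n with O => fun i _ => c i | S n => picard_step (picard n) end.

Lemma picard_step_continuous (z : bool -> R -> R) :
  (forall i t, continuous (z i) t) -> forall i t, continuous (picard_step z i) t.
Proof.
  intros Hz i t. unfold picard_step.
  apply (continuous_plus (fun _ => c i)); [apply continuous_const|].
  eapply is_derive_continuous, is_derive_primitive.
  intros s. eapply is_derive_continuous, is_derive_primitive.
  now apply along_continuous.
Qed.

Lemma picard_continuous (n : nat) : forall i t, continuous (picard n i) t.
Proof.
  induction n as [|n IH]; simpl; [intros; apply continuous_const|].
  now apply picard_step_continuous.
Qed.

Let lam := 2 * L + 1.

(** Two integrations gain [1 / lam ^ 2], and the sum of two coordinates costs a
    factor 2, so [4 * L <= lam ^ 2] gives the ratio [1 / 2]. *)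
Lemma picard_step_contracts (y z : bool -> R -> R) (C : R) :
  (forall i t, continuous (y i) t) -> (forall i t, continuous (z i) t) ->
  (forall i t, Rabs (y i t - z i t) <= C * exp (lam * Rabs t)) ->
  forall i t, Rabs (picard_step y i t - picard_step z i t)
    <= C / 2 * exp (lam * Rabs t).
Proof.
  intros Hy Hz Hyz i t. unfold picard_step.
  pose proof lipschitz_constant_nonneg as HL.
  assert (Hlam : 0 < lam) by (unfold lam; lra).
  pose proof (along_continuous y Hy i) as Cy.
  pose proof (along_continuous z Hz i) as Cz.
  assert (C1 : forall k, (forall s, continuous k s) -> forall s, continuous (primitive k) s).
  { intros k Hk s. eapply is_derive_continuous, is_derive_primitive, Hk. }
  replace (_ - _) with
    (primitive (primitive (fun s => along y i s - along z i s)) t).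
  2: { replace (c i + _ - _) with (primitive (primitive (along y i)) t -
         primitive (primitive (along z i)) t) by ring.
       rewrite <- primitive_minus by auto.
       apply RInt_ext. intros s _. now apply primitive_minus. }
  assert (HC : 0 <= C).
  { specialize (Hyz i 0). rewrite Rabs_R0, Rmult_0_r, exp_0 in Hyz.
    pose proof (Rabs_pos (y i 0 - z i 0)); lra. }
  apply Rle_trans with (L * (2 * C) / lam / lam * exp (lam * Rabs t)).
  - assert (Cd : forall s, continuous (fun s => along y i s - along z i s) s).
    { intros s. now apply (continuous_minus (along y i) (along z i)). }
    apply primitive_exp_bound; auto.
    intros s. apply primitive_exp_bound; auto.
    clear s. intros s.
    eapply Rle_trans; [apply A_lipschitz|].
    rewrite Rmult_assoc. apply Rmult_le_compat_l; [exact HL|].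
    pose proof (Hyz true s). pose proof (Hyz false s). lra.
  - apply Rmult_le_compat_r; [left; apply exp_pos|].
    apply Rmult_le_reg_r with (lam * lam); [nra|].
    replace (L * (2 * C) / lam / lam * (lam * lam)) with (L * (2 * C)) by (field; lra).
    unfold lam. nra.
Qed.

Let force0 := Rabs (A true (c true) (c false)) + Rabs (A false (c true) (c false)).

Let C0 := force0 / lam / lam.

Lemma picard_increment (n : nat) : forall i t,
  Rabs (picard (S n) i t - picard n i t) <= C0 * (/ 2) ^ n * exp (lam * Rabs t).
Proof.
  pose proof lipschitz_constant_nonneg as HL.
  assert (Hlam : 0 < lam) by (unfold lam; lra).
  induction n as [|n IH].
  - intros i t. simpl. unfold picard_step.
    replace (c i + _ - c i) with (primitive (primitive (along (fun i _ => c i) i)) t) by ring.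
    rewrite Rmult_1_r. unfold C0.
    assert (Ca : forall s, continuous (along (fun i _ => c i) i) s).
    { apply along_continuous. intros; apply continuous_const. }
    apply primitive_exp_bound; trivial.
    { intros s. eapply is_derive_continuous, is_derive_primitive, Ca. }
    intros s. apply primitive_exp_bound; trivial.
    clear s. intros s. unfold along, force0.
    pose proof (Rabs_pos (A true (c true) (c false))).
    pose proof (Rabs_pos (A false (c true) (c false))).
    assert (1 <= exp (lam * Rabs s)).
    { rewrite <- exp_0. pose proof (Rabs_pos s).
      destruct (Req_dec (lam * Rabs s) 0) as [->|]; [lra|].
      left; apply exp_increasing. nra. }
    destruct i; nra.
  - intros i t.
    replace (C0 * (/ 2) ^ S n) with (C0 * (/ 2) ^ n / 2) by (simpl; field).
    apply (picard_step_contracts (picard (S n)) (picard n)); [exact (picard_continuous (S n))|exact (picard_continuous n)|exact IH].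
Qed.

Lemma picard_cauchy (n m : nat) : forall i t,
  Rabs (picard (n + m) i t - picard n i t) <= 2 * C0 * (/ 2) ^ n * exp (lam * Rabs t).
Proof.
  intros i t.
  assert (H : Rabs (picard (n + m) i t - picard n i t) <=
    2 * C0 * ((/ 2) ^ n - (/ 2) ^ (n + m)) * exp (lam * Rabs t)).
  { induction m as [|m IH].
    - rewrite Nat.add_0_r, !Rminus_diag, Rabs_R0. lra.
    - replace (n + S m)%nat with (S (n + m)) by lia.
      pose proof (picard_increment (n + m) i t) as Hi.
      replace (picard (S (n + m)) i t - picard n i t) with
        ((picard (S (n + m)) i t - picard (n + m) i t) +
         (picard (n + m) i t - picard n i t)) by ring.
      eapply Rle_trans; [apply Rabs_triang|].
      eapply Rle_trans; [apply Rplus_le_compat; [apply Hi|apply IH]|].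
      right. simpl. field. }
  eapply Rle_trans; [exact H|].
  apply Rmult_le_compat_r; [left; apply exp_pos|].
  assert (0 < (/ 2) ^ (n + m)) by (apply pow_lt; lra).
  assert (0 <= C0).
  { pose proof (picard_increment 0 true 0) as H1.
    rewrite Rabs_R0, Rmult_0_r, exp_0 in H1.
    pose proof (Rabs_pos (picard 1 true 0 - picard 0 true 0)). simpl pow in H1. lra. }
  nra.
Qed.

Definition flow (i : bool) (t : R) : R := real (Lim_seq (fun n => picard n i t)).

Lemma pow_half_small (C : R) : is_lim_seq (fun n => C * (/ 2) ^ n) 0.
Proof.
  replace (Finite 0) with (Rbar_mult C (Finite 0)) by (simpl; f_equal; ring).
  apply is_lim_seq_scal_l. apply is_lim_seq_geom. rewrite Rabs_right; lra.
Qed.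

Lemma picard_converges (i : bool) (t : R) :
  is_lim_seq (fun n => picard n i t) (flow i t).
Proof.
  apply Lim_seq_correct', ex_lim_seq_cauchy_corr. intros eps.
  pose proof (pow_half_small (2 * (2 * C0 * exp (lam * Rabs t)))) as H.
  apply is_lim_seq_spec in H. destruct (H eps) as [N HN].
  specialize (HN N (le_n N)). rewrite Rminus_0_r in HN. apply Rabs_def2 in HN.
  exists N. intros n m Hn Hm.
  pose proof (picard_cauchy N (n - N) i t) as H1.
  pose proof (picard_cauchy N (m - N) i t) as H2.
  replace (N + (n - N))%nat with n in H1 by lia.
  replace (N + (m - N))%nat with m in H2 by lia.
  apply Rabs_le_between in H1. apply Rabs_le_between in H2.
  apply Rabs_def1; lra.
Qed.

Lemma picard_error (n : nat) (i : bool) (t : R) :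
  Rabs (flow i t - picard n i t) <= 2 * C0 * (/ 2) ^ n * exp (lam * Rabs t).
Proof.
  (* Let [m] tend to infinity in [picard_cauchy]. *)
  assert (H : is_lim_seq (fun m => Rabs (picard (m + n) i t - picard n i t))
    (Rabs (flow i t - picard n i t))).
  { apply (is_lim_seq_abs _ (Finite (flow i t - picard n i t))).
    apply is_lim_seq_minus'; [|apply is_lim_seq_const].
    apply (is_lim_seq_incr_n (fun m => picard m i t) n), picard_converges. }
  refine (is_lim_seq_le _ _ (Finite _) (Finite _) _ H (is_lim_seq_const _)).
  intros m. simpl. rewrite Nat.add_comm. apply picard_cauchy.
Qed.

Lemma flow_continuous (i : bool) (t : R) : continuous (flow i) t.
Proof.
  apply filterlim_locally. intros eps.
  pose proof lipschitz_constant_nonneg as HL.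
  pose proof (pow_half_small (2 * C0 * exp (lam * (Rabs t + 1)))) as H.
  assert (He : 0 < eps / 3) by (pose proof (cond_pos eps); lra).
  apply is_lim_seq_spec in H. destruct (H (mkposreal _ He)) as [n Hn].
  specialize (Hn n (le_n n)). simpl in Hn. rewrite Rminus_0_r in Hn.
  apply Rabs_def2 in Hn.
  assert (Hu : forall s, Rabs s <= Rabs t + 1 ->
    Rabs (flow i s - picard n i s) < eps / 3).
  { intros s Hs. eapply Rle_lt_trans; [apply picard_error|].
    apply Rle_lt_trans with (2 * C0 * exp (lam * (Rabs t + 1)) * (/ 2) ^ n); [|lra].
    assert (exp (lam * Rabs s) <= exp (lam * (Rabs t + 1))).
    { assert (Hlam : 0 < lam) by (unfold lam; lra).
      destruct (Req_dec (Rabs s) (Rabs t + 1)) as [->|]; [lra|].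
      left; apply exp_increasing; nra. }
    assert (0 <= 2 * C0 * (/ 2) ^ n).
    { pose proof (picard_error n true 0) as H1.
      rewrite Rabs_R0, Rmult_0_r, exp_0 in H1.
      pose proof (Rabs_pos (flow true 0 - picard n true 0)). lra. }
    nra. }
  pose proof (picard_continuous n i t) as Hc.
  apply filterlim_locally with (eps := mkposreal _ He) in Hc.
  assert (Hb : locally t (fun s => Rabs (s - t) < 1)).
  { exists (mkposreal 1 Rlt_0_1). intros s Hs; exact Hs. }
  generalize (filter_and _ _ Hc Hb). apply filter_imp.
  intros s [H1 H2].
  unfold ball in *; simpl in *; unfold AbsRing_ball, abs, minus, plus, opp in *; simpl in *.
  assert (Hs : Rabs s <= Rabs t + 1).
  { replace s with (t + (s - t)) by ring. pose proof (Rabs_triang t (s - t)); lra. }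
  pose proof (Hu s Hs) as H3. pose proof (Hu t ltac:(lra)) as H4.
  apply Rabs_def2 in H1. apply Rabs_def2 in H3. apply Rabs_def2 in H4.
  apply Rabs_def1; lra.
Qed.

(** The iterates [picard (S n)] converge to [flow] and, by contraction, to its
    image under the Picard operator. *)
Lemma flow_fixed_point (i : bool) (t : R) : flow i t = picard_step flow i t.
Proof.
  assert (H : is_lim_seq (fun n => picard (S n) i t) (picard_step flow i t)).
  { apply is_lim_seq_spec. intros eps.
    pose proof (pow_half_small (C0 * exp (lam * Rabs t))) as H.
    apply is_lim_seq_spec in H. destruct (H eps) as [N HN].
    exists N. intros n Hn. specialize (HN n Hn).
    rewrite Rminus_0_r in HN. apply Rabs_def2 in HN.
    rewrite Rabs_minus_sym.
    eapply Rle_lt_trans.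
    - apply (picard_step_contracts flow (picard n) (2 * C0 * (/ 2) ^ n)).
      + apply flow_continuous.
      + apply picard_continuous.
      + intros; apply picard_error.
    - lra. }
  apply is_lim_seq_unique in H.
  pose proof (picard_converges i t) as H1.
  apply is_lim_seq_incr_1, is_lim_seq_unique in H1.
  rewrite H1 in H. now injection H.
Qed.

Definition flow_velocity (i : bool) : R -> R := primitive (along flow i).

Lemma flow_initial (i : bool) : flow i 0 = c i.
Proof. rewrite flow_fixed_point. unfold picard_step. rewrite primitive_0; ring. Qed.

Lemma is_derive_flow (i : bool) (t : R) :
  is_derive (flow i) t (flow_velocity i t).
Proof.
  apply (is_derive_ext (picard_step flow i)).
  - intros s; symmetry; apply flow_fixed_point.
  - unfold picard_step. rewrite <- (Rplus_0_l (flow_velocity i t)).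
    apply (is_derive_plus (fun _ => c i) (primitive (primitive (along flow i)))).
    + apply (is_derive_const (c i)).
    + apply is_derive_primitive. intros s.
      eapply is_derive_continuous, is_derive_primitive.
      apply along_continuous, flow_continuous.
Qed.

Lemma is_derive_flow_velocity (i : bool) (t : R) :
  is_derive (flow_velocity i) t (along flow i t).
Proof.
  apply is_derive_primitive, along_continuous, flow_continuous.
Qed.

End Picard.

Definition solves (z v : bool -> R -> R) (a b : R) : Prop :=
  forall i t, a <= t <= b ->
    is_derive (z i) t (v i t) /\ is_derive (v i) t (along z i t).

(** [D t * exp (- k * t)] is nonincreasing. *)
Lemma gronwall (D D' : R -> R) (k tau : R) :
  (forall t, 0 <= t <= tau -> is_derive D t (D' t)) ->
  (forall t, 0 <= t <= tau -> D' t <= k * D t) ->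
  forall t, 0 <= t <= tau -> D t <= exp (k * t) * D 0.
Proof.
  intros Hd Hle t Ht.
  assert (H : D t * exp (- k * t) - D 0 * exp (- k * 0) <= 0 * (t - 0)).
  { apply (mean_value_le (fun t => D t * exp (- k * t))
      (fun t => D' t * exp (- k * t) + D t * (- k * exp (- k * t)))); [lra|..].
    - intros s Hs. apply (is_derive_mult D (fun t => exp (- k * t))).
      + apply Hd; lra.
      + auto_derive; [trivial|ring].
      + intros; apply Rmult_comm.
    - intros s Hs. specialize (Hle s ltac:(lra)).
      pose proof (exp_pos (- k * s)). nra. }
  rewrite Rmult_0_r, exp_0 in H.
  pose proof (exp_pos (k * t)) as He.
  assert (E : exp (- k * t) * exp (k * t) = 1).
  { rewrite <- exp_plus. replace (- k * t + k * t) with 0 by ring. apply exp_0. }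
  assert (H1 : D t * exp (- k * t) <= D 0) by lra.
  apply Rmult_le_compat_r with (r := exp (k * t)) in H1; [|lra].
  rewrite Rmult_assoc, E in H1. lra.
Qed.

(** Gronwall for the sum of the squares of the differences of positions and
    velocities.  It gives continuity in the initial positions, and uniqueness
    when these coincide. *)
Lemma dependence_on_data (z v y w : bool -> R -> R) (tau : R) :
  solves z v 0 tau -> solves y w 0 tau ->
  (forall i, v i 0 = w i 0) ->
  forall i t, 0 <= t <= tau ->
    Rabs (z i t - y i t) <= exp ((2 + 4 * L ^ 2) * tau) *
       (Rabs (z true 0 - y true 0) + Rabs (z false 0 - y false 0)) /\
    Rabs (v i t - w i t) <= exp ((2 + 4 * L ^ 2) * tau) *
       (Rabs (z true 0 - y true 0) + Rabs (z false 0 - y false 0)).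
Proof.
  intros Hz Hy Hv0.
  set (k := 2 + 4 * L ^ 2).
  set (D := fun t => (z true t - y true t) ^ 2 + (z false t - y false t) ^ 2 +
     (v true t - w true t) ^ 2 + (v false t - w false t) ^ 2).
  (* [D'] is the derivative of [D], and [D' <= k * D] by [2 * u * v <= u ^ 2 + v ^ 2]. *)
  set (D' := fun t => 2 * (z true t - y true t) * (v true t - w true t)
     + 2 * (z false t - y false t) * (v false t - w false t)
     + 2 * (v true t - w true t) * (along z true t - along y true t)
     + 2 * (v false t - w false t) * (along z false t - along y false t)).
  assert (HD : forall t, 0 <= t <= tau -> D t <= exp (k * t) * D 0).
  { apply (gronwall D D').
    - intros t Ht. unfold D, D'.
      assert (Hsq : forall p q p' q' : R -> R, is_derive p t (p' t) -> is_derive q t (q' t) ->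
         is_derive (fun t => (p t - q t) ^ 2) t (2 * (p t - q t) * (p' t - q' t))).
      { intros p q p' q' Hp Hq.
        replace (2 * (p t - q t) * (p' t - q' t)) with
          (INR 2 * (p' t - q' t) * (p t - q t) ^ Nat.pred 2) by (simpl; ring).
        apply (is_derive_pow (fun t => p t - q t) 2 t).
        now apply (is_derive_minus p q). }
      repeat apply @is_derive_plus; apply Hsq; (apply Hz || apply Hy); exact Ht.
    - intros t Ht. unfold D, D', k, along.
      pose proof lipschitz_constant_nonneg as HL.
      assert (Hsq : forall i, (A i (z true t) (z false t) - A i (y true t) (y false t)) ^ 2 <=
        2 * L ^ 2 * ((z true t - y true t) ^ 2 + (z false t - y false t) ^ 2)).
      { intros i. pose proof (A_lipschitz i (z true t) (z false t) (y true t) (y false t)) as H.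
        set (d := A i (z true t) (z false t) - _) in *.
        rewrite <- (pow2_abs d), <- (pow2_abs (z true t - y true t)),
          <- (pow2_abs (z false t - y false t)).
        pose proof (Rabs_pos d).
        set (p := Rabs (z true t - y true t)) in *.
        set (q := Rabs (z false t - y false t)) in *.
        apply Rle_trans with ((L * (p + q)) ^ 2); [apply pow_incr; lra|].
        assert (0 <= L ^ 2 * (p - q) ^ 2) by (apply Rmult_le_pos; apply pow2_ge_0).
        nra. }
      pose proof (Hsq true) as S1. pose proof (Hsq false) as S2.
      set (d1 := A true (z true t) (z false t) - _) in *.
      set (d2 := A false (z true t) (z false t) - _) in *.
      set (e1 := z true t - y true t) in *. set (e2 := z false t - y false t) in *.
      set (f1 := v true t - w true t) in *. set (f2 := v false t - w false t) in *.
      pose proof (pow2_ge_0 (e1 - f1)). pose proof (pow2_ge_0 (e2 - f2)).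
      pose proof (pow2_ge_0 (f1 - d1)). pose proof (pow2_ge_0 (f2 - d2)).
      assert (0 <= 4 * L ^ 2 * (f1 ^ 2 + f2 ^ 2)).
      { pose proof (pow2_ge_0 f1). pose proof (pow2_ge_0 f2). pose proof (pow2_ge_0 L). nra. }
      pose proof (pow2_ge_0 e1). pose proof (pow2_ge_0 e2). nra. }
  intros i t Ht. specialize (HD t Ht).
  set (E := exp (k * tau)).
  set (S := Rabs (z true 0 - y true 0) + Rabs (z false 0 - y false 0)).
  assert (HS : D 0 <= S ^ 2).
  { unfold D, S. rewrite !Hv0, !Rminus_diag.
    rewrite <- (pow2_abs (z true 0 - y true 0)), <- (pow2_abs (z false 0 - y false 0)).
    pose proof (Rabs_pos (z true 0 - y true 0)). pose proof (Rabs_pos (z false 0 - y false 0)).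
    nra. }
  assert (HS0 : 0 <= S).
  { unfold S. pose proof (Rabs_pos (z true 0 - y true 0)).
    pose proof (Rabs_pos (z false 0 - y false 0)). lra. }
  assert (Hk : 0 <= k) by (unfold k; pose proof (pow2_ge_0 L); lra).
  assert (HE1 : 1 <= E).
  { unfold E. rewrite <- exp_0. assert (0 <= k * tau) by nra.
    destruct (Req_dec (k * tau) 0) as [->|]; [lra|]. left; apply exp_increasing; lra. }
  assert (HEt : exp (k * t) <= E).
  { unfold E. destruct (Req_dec (k * t) (k * tau)) as [->|]; [lra|].
    left; apply exp_increasing; nra. }
  assert (HDt : D t <= (E * S) ^ 2).
  { apply Rle_trans with (E * S ^ 2).
    - eapply Rle_trans; [exact HD|]. pose proof (exp_pos (k * t)).
      assert (0 <= D 0).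
      { unfold D. repeat apply Rplus_le_le_0_compat; apply pow2_ge_0. }
      nra.
    - pose proof (pow2_ge_0 S). nra. }
  assert (HES : 0 <= E * S) by (apply Rmult_le_pos; lra).
  assert (Hall : forall d, d ^ 2 <= (E * S) ^ 2 -> Rabs d <= E * S).
    { intros d Hd. apply Rsqr_incr_0_var; [|exact HES]. rewrite <- !Rsqr_pow2 in Hd.
    now rewrite <- Rsqr_abs. }
  unfold D in HDt.
  pose proof (pow2_ge_0 (z true t - y true t)). pose proof (pow2_ge_0 (z false t - y false t)).
  pose proof (pow2_ge_0 (v true t - w true t)). pose proof (pow2_ge_0 (v false t - w false t)).
  destruct i; split; apply Hall; lra.
Qed.

End LipschitzForce.

(** * Continuity on an interval *)

(** The first zero is the supremum of the times up to which [u] stays negative. *)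
Lemma first_zero (u : R -> R) (a b : R) :
  a <= b -> (forall t, a <= t <= b -> continuity_pt u t) ->
  u a < 0 -> 0 <= u b ->
  exists c, a <= c <= b /\ u c = 0 /\ forall t, a <= t < c -> u t < 0.
Proof.
  intros Hab Hc Ha Hb.
  set (E := fun t => a <= t <= b /\ forall s, a <= s <= t -> u s < 0).
  destruct (completeness E) as [c [Hub Hlub]].
  { exists b. intros t [Ht _]. lra. }
  { exists a. split; [lra|]. intros s Hs. now replace s with a by lra. }
  assert (Hac : a <= c).
  { apply Hub. split; [lra|]. intros s Hs. now replace s with a by lra. }
  assert (Hcb : c <= b) by (apply Hlub; intros t [Ht _]; lra).
  assert (Hneg : forall t, a <= t < c -> u t < 0).
  { intros t Ht. apply Rnot_le_lt. intros Hut.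
    assert (c <= t); [|lra]. apply Hlub. intros s [Hs1 Hs2].
    apply Rnot_lt_le. intros Hst. specialize (Hs2 t ltac:(lra)). lra. }
  assert (Hnear : forall eta, 0 < eta -> exists del, 0 < del /\
    forall s, Rabs (s - c) < del -> Rabs (u s - u c) < eta).
  { intros eta Heta. destruct (Hc c ltac:(lra) eta Heta) as [del [Hd1 Hd2]].
    exists del. split; [exact Hd1|]. intros s Hs.
    destruct (Req_dec s c) as [->|Hne]; [now rewrite Rminus_diag, Rabs_R0|].
    apply (Hd2 s). split; [split; [exact I|auto]|exact Hs]. }
  exists c. split; [lra|]. split; [|exact Hneg].
  apply Rle_antisym; apply Rnot_lt_le; intros Hlt.
  - destruct (Hnear (u c) ltac:(lra)) as [del [Hd1 Hd2]].
    destruct (Req_dec a c) as [<-|Hne]; [lra|].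
    set (t := Rmax a (c - del / 2)).
    assert (a <= t < c) by (unfold t; split; [apply Rmax_l|apply Rmax_lub_lt; lra]).
    assert (c - del / 2 <= t) by apply Rmax_r.
    specialize (Hneg t ltac:(lra)).
    specialize (Hd2 t ltac:(apply Rabs_def1; lra)). apply Rabs_def2 in Hd2. lra.
  - destruct (Hnear (- u c) ltac:(lra)) as [del [Hd1 Hd2]].
    assert (Hcb' : c < b) by (destruct (Req_dec c b) as [->|]; lra).
    set (t := Rmin b (c + del / 2)).
    assert (c < t <= b) by (unfold t; split; [apply Rmin_glb_lt; lra|apply Rmin_l]).
    assert (t <= c + del / 2) by apply Rmin_r.
    assert (t <= c); [|lra]. apply Hub. split; [lra|]. intros s Hs.
    destruct (Rlt_dec s c) as [|Hsc]; [apply Hneg; lra|].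
    specialize (Hd2 s ltac:(apply Rabs_def1; lra)). apply Rabs_def2 in Hd2. lra.
Qed.

Lemma intermediate_value (u : R -> R) (a b m : R) :
  a <= b -> (forall t, a <= t <= b -> continuity_pt u t) ->
  u b <= m <= u a -> exists c, a <= c <= b /\ u c = m.
Proof.
  intros Hab Hc Hm.
  destruct (Req_dec (u a) m) as [<-|Hne]; [exists a; split; [lra|reflexivity]|].
  destruct (first_zero (fun t => m - u t) a b Hab) as [c [Hc1 [Hc2 _]]]; [|lra..|].
  - intros t Ht. apply continuity_pt_minus; [|now apply Hc].
    now apply continuity_pt_const.
  - exists c. split; [exact Hc1|lra].
Qed.

(** * Truncated forces *)

Definition clamp (l u s : R) : R := Rmax l (Rmin u s).

Lemma clamp_range l u s : l <= u -> l <= clamp l u s <= u.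
Proof.
  intros H. unfold clamp. split; [apply Rmax_l|].
  apply Rmax_lub; [exact H|apply Rmin_l].
Qed.

Lemma clamp_id l u s : l <= s <= u -> clamp l u s = s.
Proof. intros H. unfold clamp. rewrite Rmin_right, Rmax_right; lra. Qed.

Lemma clamp_below l u s : s <= l -> clamp l u s = l.
Proof.
  intros H. unfold clamp. apply Rmax_left.
  eapply Rle_trans; [apply Rmin_r|exact H].
Qed.

Lemma clamp_above l u s : l <= u -> u <= s -> clamp l u s = u.
Proof. intros H1 H2. unfold clamp. rewrite Rmin_left, Rmax_right; lra. Qed.

(** Raising the lower level raises the value; for a nondecreasing force this
    compares the attraction truncated at two different levels. *)
Lemma clamp_mono l l' u s s' : l <= l' -> s <= s' -> clamp l u s <= clamp l' u s'.
Proof.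
  intros Hl Hs. unfold clamp. apply Rmax_case.
  - eapply Rle_trans; [exact Hl|apply Rmax_l].
  - eapply Rle_trans; [|apply Rmax_r]. now apply Rle_min_compat_l.
Qed.

Lemma clamp_1_lipschitz l u s s' : Rabs (clamp l u s - clamp l u s') <= Rabs (s - s').
Proof.
  unfold clamp, Rmax, Rmin.
  repeat destruct (Rle_dec _ _); unfold Rabs; repeat destruct (Rcase_abs _); lra.
Qed.

Section Truncation.

(* In the application [phi] is [f'], [psi] is [g'] and [gamma] is [g]. *)
Variables phi psi gamma : R -> R.
Hypothesis phi_mono : forall x y, 0 < x <= y -> phi x <= phi y.
Hypothesis phi_le0 : forall x, 0 < x -> phi x <= 0.
Hypothesis psi_mono : forall x y, 0 < x <= y -> psi x <= psi y.
Hypothesis psi_le0 : forall x, 0 < x -> psi x <= 0.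
Hypothesis gamma_derive : forall x, 0 < x -> is_derive gamma x (psi x).

Variables T s0 d M : R.

Definition pull (l x : R) : R := phi (clamp l M x).
Definition push (r : R) : R := psi (clamp d M r).

(** Coordinate [true] is the inner particle [x], [false] the outer one [y].  Only
    the attraction of the inner particle is truncated at the small level [eps];
    the outer one never comes below [s0], so its attraction can be truncated
    there, which makes it bounded by [- phi s0] independently of [eps]. *)
Definition force (eps : R) (i : bool) (x y : R) : R :=
  if i then pull eps x + push (y - x) else pull s0 y - push (y - x).

(* [K] bounds the attraction on the outer particle, and [W] bounds the relative
   velocity while the inner particle is beyond [s0 / 2]. *)
Let K := - phi s0.
Let W := T * (2 * K - phi (s0 / 2)).
(** How far the outer particle can be from [M], plus how far the inner one can be
    from the nucleus, when the outer one reaches [M]; the two bounds are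
    [K * T ^ 2] and [s0 + 2 * K * T ^ 2]. *)
Definition spread : R := s0 + 3 * (- phi s0) * T ^ 2.

Hypothesis T_pos : 0 < T.
Hypothesis s0_pos : 0 < s0.
(* A fall from rest at [s0] with acceleration [K] takes less time than [T]. *)
Hypothesis s0_fall : 2 * s0 < K * T ^ 2.
Hypothesis d_pos : 0 < d.
Hypothesis d_steep : K < - psi d.
Hypothesis d_high : K * T * W < gamma d - gamma (d + s0 / 2).
Hypothesis M_large : d < M - spread.
Hypothesis M_pull : phi M < psi (M - spread).

Lemma K_pos : 0 < K.
Proof. clear - s0_fall s0_pos T_pos. assert (0 < T ^ 2) by (apply pow_lt; exact T_pos). nra. Qed.

Lemma s0_lt_M : s0 < M /\ d < M /\ s0 + 2 * K * T ^ 2 < M.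
Proof.
  pose proof K_pos. pose proof (pow_lt T 2 T_pos). pose proof M_large as HM. unfold spread in HM. fold K in HM.
  assert (0 < K * T ^ 2) by nra. lra.
Qed.

Lemma pull_mono l l' x y : 0 < l <= l' -> l' <= M -> x <= y -> pull l x <= pull l' y.
Proof.
  intros Hl HM Hxy. apply phi_mono. split.
  - destruct (clamp_range l M x); lra.
  - apply clamp_mono; lra.
Qed.

Lemma pull_range l x : 0 < l <= M -> phi l <= pull l x <= phi M.
Proof.
  intros Hl. destruct (clamp_range l M x) as [H1 H2]; [lra|].
  split; apply phi_mono; lra.
Qed.

Lemma push_mono r r' : r <= r' -> push r <= push r'.
Proof.
  intros H. destruct s0_lt_M as [_ [HM _]]. apply psi_mono. split.
  - destruct (clamp_range d M r); lra.
  - apply clamp_mono; lra.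
Qed.

Lemma push_range r : psi d <= push r <= 0.
Proof.
  destruct s0_lt_M as [_ [HM _]].
  destruct (clamp_range d M r) as [H1 H2]; [lra|].
  split; [apply psi_mono|apply psi_le0]; lra.
Qed.

Lemma phi_M_neg : phi M < 0.
Proof. assert (psi (M - spread) <= 0) by (apply psi_le0; lra). lra. Qed.

(** * A priori estimates for truncated arcs *)

Section APriori.

Variables (eps : R) (x y p q : R -> R).
Hypothesis eps_range : 0 < eps < s0.
Hypothesis dx : forall t, 0 <= t <= T -> is_derive x t (p t).
Hypothesis dy : forall t, 0 <= t <= T -> is_derive y t (q t).
Hypothesis dp : forall t, 0 <= t <= T -> is_derive p t (force eps true (x t) (y t)).
Hypothesis dq : forall t, 0 <= t <= T -> is_derive q t (force eps false (x t) (y t)).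
Hypothesis p_0 : p 0 = 0.
Hypothesis q_0 : q 0 = 0.
Hypothesis x_T : x T = eps.
Hypothesis q_T : q T = 0.

Lemma p_antitone s t : 0 <= s <= t -> t <= T -> p t <= p s.
Proof.
  intros Hs Ht. pose proof s0_lt_M as HM. pose proof phi_M_neg.
  assert (p t - p s <= 0 * (t - s)); [|lra].
  eapply mean_value_le; [lra|intros; apply dp; lra|].
  intros r Hr. unfold force. pose proof (push_range (y r - x r)).
  pose proof (pull_range eps (x r) ltac:(lra)). lra.
Qed.

Lemma p_le0 t : 0 <= t <= T -> p t <= 0.
Proof. intros Ht. rewrite <- p_0. apply p_antitone; lra. Qed.

Lemma x_antitone s t : 0 <= s <= t -> t <= T -> x t <= x s.
Proof.
  intros Hs Ht.
  assert (x t - x s <= 0 * (t - s)); [|lra].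
  eapply mean_value_le; [lra|intros; apply dx; lra|].
  intros r Hr. apply p_le0; lra.
Qed.

(** A concave function lies above its chord, here from [(0, x 0)] to [(T, eps)]. *)
Lemma x_concave t : 0 <= t <= T -> x 0 * (1 - t / T) <= x t.
Proof.
  intros Ht.
  assert (H1 : p t * (t - 0) <= x t - x 0).
  { eapply mean_value_ge; [lra|intros; apply dx; lra|].
    intros r Hr; apply p_antitone; lra. }
  assert (H2 : x T - x t <= p t * (T - t)).
  { eapply mean_value_le; [lra|intros; apply dx; lra|].
    intros r Hr; apply p_antitone; lra. }
  rewrite x_T in H2.
  apply Rmult_le_reg_r with T; [exact T_pos|].
  replace (x 0 * (1 - t / T) * T) with (x 0 * (T - t)) by (field; lra).
  nra.
Qed.

(** Released below [s0], the inner particle would feel an attraction of at least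
    [K] and cross the nucleus before time [T], by [s0_fall]. *)
Lemma x_0_lower : s0 <= x 0.
Proof.
  apply Rnot_lt_le. intros Hlt. pose proof s0_lt_M as HM. pose proof K_pos.
  destruct (motion_from_rest_le x p (fun t => force eps true (x t) (y t)) (- K) T) as [_ H1];
    [lra|exact dx|exact dp|exact p_0|..].
  - intros s Hs. unfold force. pose proof (push_range (y s - x s)).
    assert (Hpull : pull eps (x s) <= pull s0 s0).
    { apply pull_mono; [lra..|]. pose proof (x_antitone 0 s ltac:(lra) ltac:(lra)). lra. }
    unfold pull at 2 in Hpull. rewrite clamp_id in Hpull by lra. unfold K; lra.
  - rewrite x_T in H1. replace (- K * T ^ 2 / 2) with (- (K * T ^ 2) / 2) in H1 by field. lra.
Qed.

(** For [x <= y] the attraction is at least as strong on the inner particle and the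
    repulsion acts on both, so their relative acceleration is nonnegative.  For
    [y < x] the push has its extreme value, which exceeds the attraction of
    the outer particle. *)
Lemma relative_velocity_monotone s t : 0 <= s <= t -> t <= T -> q s - p s <= q t - p t.
Proof.
  intros Hs Ht. pose proof s0_lt_M as HM. pose proof K_pos.
  assert (0 * (t - s) <= (q t - p t) - (q s - p s)); [|lra].
  apply (mean_value_ge (fun t => q t - p t)
    (fun t => force eps false (x t) (y t) - force eps true (x t) (y t))); [lra|..].
  - intros r Hr. apply (is_derive_minus q p); [apply dq|apply dp]; lra.
  - intros r Hr. unfold force. destruct (Rle_dec (x r) (y r)) as [Hle|Hgt].
    + pose proof (pull_mono eps s0 (x r) (y r) ltac:(lra) ltac:(lra) Hle).
      pose proof (push_range (y r - x r)). lra.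
    + pose proof (pull_range eps (x r) ltac:(lra)).
      pose proof (pull_range s0 (y r) ltac:(lra)). pose proof phi_M_neg.
      assert (push (y r - x r) = psi d) by (unfold push; rewrite clamp_below; lra).
      unfold K in *; lra.
Qed.

Lemma separation_monotone s t : 0 <= s <= t -> t <= T -> y s - x s <= y t - x t.
Proof.
  intros Hs Ht.
  assert (0 * (t - s) <= (y t - x t) - (y s - x s)); [|lra].
  apply (mean_value_ge (fun t => y t - x t) (fun t => q t - p t)); [lra|..].
  - intros r Hr. apply (is_derive_minus y x); [apply dy|apply dx]; lra.
  - intros r Hr. pose proof (relative_velocity_monotone 0 r ltac:(lra) ltac:(lra)). lra.
Qed.

(** At a negative minimum of [q] the acceleration vanishes.  From then on, as long
    as [q < 0], the outer particle approaches the nucleus and the separation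
    grows, so both forces change in the direction of the nucleus and [q] keeps
    decreasing; it could not return to [0]. *)
Lemma q_nonneg t : 0 <= t <= T -> 0 <= q t.
Proof.
  intros Ht. pose proof s0_lt_M as HM.
  assert (Cq : forall s, 0 <= s <= T -> continuity_pt q s).
  { intros s Hs. apply continuity_pt_filterlim.
    eapply is_derive_continuous, dq, Hs. }
  destruct (continuity_ab_min q 0 T ltac:(lra) Cq) as [m [Hm Hm']].
  apply Rnot_lt_le. intros Hneg.
  assert (Hqm : q m < 0) by (specialize (Hm t Ht); lra).
  assert (0 < m < T).
  { split; apply Rnot_le_lt; intros H.
    - replace m with 0 in Hqm by lra. lra.
    - replace m with T in Hqm by lra. lra. }
  assert (Hstat : force eps false (x m) (y m) = 0).
  { pose proof (dq m ltac:(lra)) as Hd. apply is_derive_Reals in Hd.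
    rewrite <- (deriv_minimum q 0 T m (exist _ _ Hd)); [reflexivity|lra|lra|].
    intros s Hs1 Hs2. apply Hm; lra. }
  destruct (first_zero q m T) as [c [Hc [Hqc Hlt]]]; [lra|intros; apply Cq; lra|lra|lra|].
  assert (q c - q m <= 0 * (c - m)); [|lra].
  eapply mean_value_le; [lra|intros; apply dq; lra|].
  intros s Hs. rewrite <- Hstat. unfold force.
  assert (Hy : y s - y m <= 0 * (s - m)).
  { eapply mean_value_le; [lra|intros; apply dy; lra|].
    intros r Hr. destruct (Req_dec r c) as [->|]; [lra|].
    left; apply Hlt; lra. }
  pose proof (pull_mono s0 s0 (y s) (y m) ltac:(lra) ltac:(lra) ltac:(lra)).
  pose proof (push_mono _ _ (separation_monotone m s ltac:(lra) ltac:(lra))). lra.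
Qed.

Lemma y_monotone s t : 0 <= s <= t -> t <= T -> y s <= y t.
Proof.
  intros Hs Ht.
  assert (0 * (t - s) <= y t - y s); [|lra].
  eapply mean_value_ge; [lra|intros; apply dy; lra|].
  intros r Hr; apply q_nonneg; lra.
Qed.

(** The outer particle has to be stopped at time [T] by an attraction of at
    most [K]. *)
Lemma q_upper t : 0 <= t <= T -> q t <= K * (T - t).
Proof.
  intros Ht. pose proof s0_lt_M as HM.
  assert (- K * (T - t) <= q T - q t); [|lra].
  eapply mean_value_ge; [lra|intros; apply dq; lra|].
  intros r Hr. unfold force. pose proof (push_range (y r - x r)).
  pose proof (pull_range s0 (y r) ltac:(lra)). unfold K; lra.
Qed.

(** The repulsion cancels in the sum of the velocities, which therefore only
    feels the attraction; [q_upper] takes care of [q]. *)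
Lemma p_lower t : 0 <= t <= T -> - (T * (K - pull eps (x t))) <= p t.
Proof.
  intros Ht. pose proof s0_lt_M as HM. pose proof K_pos.
  assert (H1 : (pull eps (x t) - K) * (t - 0) <= (p t + q t) - (p 0 + q 0)).
  { apply (mean_value_ge (fun t => p t + q t) (fun t =>
      force eps true (x t) (y t) + force eps false (x t) (y t))); [lra|..].
    - intros r Hr. apply (is_derive_plus p q); [apply dp|apply dq]; lra.
    - intros r Hr. unfold force.
      pose proof (pull_mono eps eps (x t) (x r) ltac:(lra) ltac:(lra)
        (x_antitone r t ltac:(lra) ltac:(lra))).
      pose proof (pull_range s0 (y r) ltac:(lra)). unfold K; lra. }
  pose proof (q_upper t Ht).
  pose proof (pull_range eps (x t) ltac:(lra)). pose proof phi_M_neg.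
  rewrite p_0, q_0 in H1. nra.
Qed.

Lemma W_large : s0 <= W * T /\ 0 < W.
Proof.
  pose proof K_pos.
  assert (phi (s0 / 2) <= phi s0) by (apply phi_mono; lra).
  assert (3 * K * T <= W) by (unfold W, K; nra).
  split; [|nra]. assert (3 * K * T ^ 2 <= W * T) by nra. nra.
Qed.

(** If the initial separation is below [d], it stays below [d + W * t] as long as
    [x] is above [s0 / 2], that is at least until [t1 = s0 / (2 * W)].  The
    repulsion collected by [q] up to [t1] is then at least the integral of
    [- psi (d + W * t)], that is [(gamma d - gamma (d + s0 / 2)) / W], which
    by [d_high] exceeds what [q_upper] allows. *)
Lemma separation_0_lower : d <= y 0 - x 0.
Proof.
  apply Rnot_lt_le. intros Hlt.
  pose proof s0_lt_M as HM. destruct W_large as [HW HW0]. pose proof K_pos.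
  set (t1 := s0 / (2 * W)).
  assert (Ht1 : W * t1 = s0 / 2) by (unfold t1; field; lra).
  assert (Ht1' : 0 < t1 <= T / 2).
  { split; [unfold t1; apply Rdiv_lt_0_compat; lra|].
    apply Rmult_le_reg_l with W; [exact HW0|]. rewrite Ht1. lra. }
  assert (Hx : forall t, 0 <= t <= t1 -> s0 / 2 <= x t).
  { intros t Ht. pose proof (x_concave t ltac:(lra)) as H1. pose proof x_0_lower.
    assert (/ 2 <= 1 - t / T).
    { apply Rmult_le_reg_r with T; [exact T_pos|].
      replace ((1 - t / T) * T) with (T - t) by (field; lra). lra. }
    nra. }
  assert (Hr : forall t, 0 <= t <= t1 -> y t - x t <= d + W * t).
  { intros t Ht.
    assert ((y t - x t) - (y 0 - x 0) <= W * (t - 0)); [|lra].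
    apply (mean_value_le (fun t => y t - x t) (fun t => q t - p t)); [lra|..].
    - intros r Hr. apply (is_derive_minus y x); [apply dy|apply dx]; lra.
    - intros r Hr. pose proof (p_lower r ltac:(lra)). pose proof (q_upper r ltac:(lra)).
      specialize (Hx r ltac:(lra)).
      assert (phi (s0 / 2) <= pull eps (x r)).
      { apply phi_mono. split; [lra|].
        apply Rle_trans with (Rmin M (x r)); [|apply Rmax_r].
        apply Rmin_glb; lra. }
      unfold W. nra. }
  (* [gamma (d + W * t) / W] is a primitive of [psi (d + W * t)], so its sum with
     [q] only loses what the attraction takes. *)
  assert (H1 : - K * (t1 - 0) <= (q t1 + gamma (d + W * t1) / W) - (q 0 + gamma (d + W * 0) / W)).
  { apply (mean_value_ge (fun t => q t + gamma (d + W * t) / W)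
      (fun t => force eps false (x t) (y t) + psi (d + W * t))); [lra|..].
    - intros t Ht. apply (is_derive_plus q (fun t => gamma (d + W * t) / W)).
      + apply dq; lra.
      + assert (Hg : is_derive (fun t => gamma (d + W * t)) t (W * psi (d + W * t))).
        { apply (is_derive_comp gamma (fun t => d + W * t) t (psi (d + W * t)) W).
          - apply gamma_derive. nra.
          - auto_derive; [trivial|ring]. }
        apply (is_derive_scal (fun t => gamma (d + W * t)) t (/ W)) in Hg.
        apply (is_derive_ext (fun t => / W * gamma (d + W * t))).
        * intros; apply Rmult_comm.
        * replace (psi (d + W * t)) with (/ W * (W * psi (d + W * t))) by (field; lra).
          exact Hg.
    - intros t Ht. unfold force.
      pose proof (pull_range s0 (y t) ltac:(lra)).
      assert (push (y t - x t) <= psi (d + W * t)).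
      { apply psi_mono. specialize (Hr t Ht).
        destruct (clamp_range d M (y t - x t)) as [? _]; [lra|]. split; [lra|].
        apply Rmax_lub; [nra|]. eapply Rle_trans; [apply Rmin_r|exact Hr]. }
      unfold K; lra. }
  rewrite q_0, Rmult_0_r, Rplus_0_r, Ht1 in H1.
  pose proof (q_upper t1 ltac:(lra)).
  assert (H2 : (gamma d - gamma (d + s0 / 2)) / W <= K * T).
  { replace ((gamma d - gamma (d + s0 / 2)) / W) with
      (gamma d / W - gamma (d + s0 / 2) / W) by (field; lra). lra. }
  apply Rmult_le_compat_r with (r := W) in H2; [|lra].
  replace ((gamma d - gamma (d + s0 / 2)) / W * W) with
    (gamma d - gamma (d + s0 / 2)) in H2 by (field; lra). lra.
Qed.

Lemma x_continuous t : 0 <= t <= T -> continuity_pt x t.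
Proof.
  intros Ht. apply continuity_pt_filterlim. eapply is_derive_continuous, dx, Ht.
Qed.

(** Below the height [eta] there is nothing to prove; above it the speed is at most
    [T * (K - phi eta)], and the height [eta] has still to be crossed before
    time [T].  The bound does not involve [eps], which makes the limit arc
    continuous at the collision. *)
Lemma x_upper_near_T eta t : eps <= eta <= M -> 0 <= t <= T ->
  x t <= eta + T * (K - phi eta) * (T - t).
Proof.
  intros Heta Ht. pose proof s0_lt_M as HM. pose proof K_pos.
  assert (Hphi : phi eta <= 0) by (apply phi_le0; lra).
  assert (HL : 0 <= T * (K - phi eta)) by (apply Rmult_le_pos; lra).
  destruct (Rle_dec (x t) eta) as [Hle|Hgt].
  { assert (0 <= T * (K - phi eta) * (T - t)) by (apply Rmult_le_pos; lra). lra. }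
  destruct (intermediate_value x t T eta) as [c [Hc Hxc]];
    [lra|intros; apply x_continuous; lra|lra|].
  assert (- (T * (K - phi eta)) * (c - t) <= x c - x t).
  { eapply mean_value_ge; [lra|intros; apply dx; lra|].
    intros r Hr. eapply Rle_trans; [|apply p_lower; lra].
    pose proof (x_antitone r c ltac:(lra) ltac:(lra)).
    assert (phi eta <= pull eps (x r)).
    { apply phi_mono. split; [lra|].
      apply Rle_trans with (Rmin M (x r)); [|apply Rmax_r].
      apply Rmin_glb; lra. }
    nra. }
  nra.
Qed.

Lemma x_0_upper : x 0 <= s0 + 2 * K * T ^ 2.
Proof.
  pose proof s0_lt_M.
  eapply Rle_trans; [apply (x_upper_near_T s0); lra|]. right. unfold K. ring.
Qed.

(** Otherwise [y] stays above [M - K * T ^ 2], hence the separation above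
    [M - spread], and by [M_pull] the attraction dominates at all times, which
    contradicts [q 0 = q T]. *)
Lemma y_T_upper : y T < M.
Proof.
  apply Rnot_le_lt. intros HyT. pose proof s0_lt_M as HM. pose proof K_pos.
  assert (Hy0 : y T - y 0 <= (K * T) * (T - 0)).
  { eapply mean_value_le; [lra|intros; apply dy; lra|].
    intros r Hr. pose proof (q_upper r Hr). nra. }
  assert (Hr0 : M - spread <= y 0 - x 0).
  { pose proof x_0_upper. unfold spread. fold K. nra. }
  assert (Hend : q T - q 0 <= (phi M - psi (M - spread)) * (T - 0)).
  { eapply mean_value_le; [lra|intros; apply dq; lra|].
    intros r Hr. unfold force. pose proof (pull_range s0 (y r) ltac:(lra)).
    pose proof (separation_monotone 0 r ltac:(lra) ltac:(lra)).
    assert (psi (M - spread) <= push (y r - x r)).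
    { apply psi_mono. split; [lra|].
      apply Rle_trans with (Rmin M (y r - x r)); [|apply Rmax_r].
      apply Rmin_glb; [unfold spread; fold K|lra].
      assert (0 < K * T ^ 2) by (pose proof (pow_lt T 2 T_pos); nra). lra. }
    lra. }
  rewrite q_T, q_0 in Hend. nra.
Qed.

(** Along a solution of the truncated boundary value problem all clamps are
    inactive, and what is needed for the limit [eps -> 0] is uniform in [eps]. *)
Lemma a_priori_bounds t : 0 <= t <= T ->
  eps <= x t <= M /\ s0 * (1 - t / T) <= x t /\
  s0 <= y t <= M /\ d <= y t - x t <= M /\ 0 <= q t <= K * (T - t) /\
  (forall eta, eps <= eta <= M -> x t <= eta + T * (K - phi eta) * (T - t)).
Proof.
  intros Ht. pose proof s0_lt_M as HM.
  pose proof (x_antitone t T ltac:(lra) ltac:(lra)).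
  pose proof (x_antitone 0 t ltac:(lra) ltac:(lra)).
  pose proof x_0_lower. pose proof x_0_upper.
  pose proof separation_0_lower.
  pose proof (separation_monotone 0 t ltac:(lra) ltac:(lra)).
  pose proof (y_monotone 0 t ltac:(lra) ltac:(lra)).
  pose proof (y_monotone t T ltac:(lra) ltac:(lra)).
  pose proof y_T_upper. pose proof (q_upper t Ht). pose proof (q_nonneg t Ht).
  pose proof (x_concave t Ht).
  assert (0 <= 1 - t / T).
  { apply Rmult_le_reg_r with T; [exact T_pos|].
    replace ((1 - t / T) * T) with (T - t) by (field; lra). lra. }
  repeat split; try lra; try nra.
  intros eta Heta. now apply x_upper_near_T.
Qed.

End APriori.
End Truncation.

(** * Choice of the truncation levels *)

Lemma C2_is_derive (f : R -> R) : C2_on (fun s => 0 < s) f ->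
  forall s, 0 < s -> is_derive f s (Derive f s).
Proof. intros H s Hs. apply Derive_correct, H, Hs. Qed.

Lemma C2_is_derive_Derive (f : R -> R) : C2_on (fun s => 0 < s) f ->
  forall s, 0 < s -> is_derive (Derive f) s (Derive_n f 2 s).
Proof. intros H s Hs. apply (Derive_correct (Derive f)), H, Hs. Qed.

Lemma convex_Derive_mono (f : R -> R) : C2_on (fun s => 0 < s) f ->
  (forall s, 0 < s -> 0 <= Derive_n f 2 s) ->
  forall x y, 0 < x <= y -> Derive f x <= Derive f y.
Proof.
  intros Hf Hc x y Hxy.
  assert (0 * (y - x) <= Derive f y - Derive f x); [|lra].
  eapply mean_value_ge; [lra|..].
  - intros t Ht. apply C2_is_derive_Derive; [exact Hf|lra].
  - intros t Ht. apply Hc; lra.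
Qed.

Lemma clamped_Derive_lipschitz (f : R -> R) (l u : R) :
  C2_on (fun s => 0 < s) f -> (forall s, 0 < s -> 0 <= Derive_n f 2 s) -> 0 < l <= u ->
  exists L, 0 <= L /\ forall x y,
    Rabs (Derive f (clamp l u x) - Derive f (clamp l u y)) <= L * Rabs (x - y).
Proof.
  intros Hf Hc Hlu.
  destruct (continuity_ab_maj (Derive_n f 2) l u (proj2 Hlu)) as [m [Hm Hm']].
  { intros c Hcc. apply continuity_pt_filterlim. apply Hf; lra. }
  assert (HL : 0 <= Derive_n f 2 m) by (apply Hc; lra).
  exists (Derive_n f 2 m). split; [exact HL|].
  assert (H : forall x y, l <= x <= y -> y <= u ->
    Rabs (Derive f x - Derive f y) <= Derive_n f 2 m * Rabs (x - y)).
  { intros x y Hx Hy. pose proof (convex_Derive_mono f Hf Hc x y ltac:(lra)).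
    rewrite (Rabs_left1 (x - y)), (Rabs_left1 (Derive f x - _)) by lra.
    assert (Derive f y - Derive f x <= Derive_n f 2 m * (y - x)); [|lra].
    eapply mean_value_le; [lra|..].
    - intros t Ht. apply C2_is_derive_Derive; [exact Hf|lra].
    - intros t Ht. apply Hm; lra. }
  intros x y.
  eapply Rle_trans; [|apply Rmult_le_compat_l; [exact HL|apply clamp_1_lipschitz with (l := l) (u := u)]].
  pose proof (clamp_range l u x (proj2 Hlu)). pose proof (clamp_range l u y (proj2 Hlu)).
  destruct (Rle_dec (clamp l u x) (clamp l u y)).
  - apply H; lra.
  - rewrite Rabs_minus_sym, (Rabs_minus_sym (clamp l u x)). apply H; lra.
Qed.

Lemma force_lipschitz (f g : R -> R) (s0 d M eps : R) :
  C2_on (fun s => 0 < s) f -> (forall s, 0 < s -> 0 <= Derive_n f 2 s) ->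
  C2_on (fun s => 0 < s) g -> (forall s, 0 < s -> 0 <= Derive_n g 2 s) ->
  0 < eps <= M -> 0 < s0 <= M -> 0 < d <= M ->
  exists L, forall i x y x' y',
    Rabs (force (Derive f) (Derive g) s0 d M eps i x y
        - force (Derive f) (Derive g) s0 d M eps i x' y')
      <= L * (Rabs (x - x') + Rabs (y - y')).
Proof.
  intros Hf Hf2 Hg Hg2 He Hs Hd.
  destruct (clamped_Derive_lipschitz f eps M Hf Hf2 He) as [L1 [HL1 H1]].
  destruct (clamped_Derive_lipschitz f s0 M Hf Hf2 Hs) as [L2 [HL2 H2]].
  destruct (clamped_Derive_lipschitz g d M Hg Hg2 Hd) as [L3 [HL3 H3]].
  exists (L1 + L2 + L3). intros i x y x' y'.
  specialize (H1 x x'). specialize (H2 y y'). specialize (H3 (y - x) (y' - x')).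
  pose proof (Rabs_pos (x - x')). pose proof (Rabs_pos (y - y')).
  assert (Hr : Rabs (y - x - (y' - x')) <= Rabs (x - x') + Rabs (y - y')).
  { replace (y - x - (y' - x')) with ((y - y') + - (x - x')) by ring.
    eapply Rle_trans; [apply Rabs_triang|]. rewrite Rabs_Ropp. lra. }
  unfold force, pull, push.
  apply Rmult_le_compat_l with (r := L3) in Hr; [|exact HL3].
  apply Rabs_le_between in H1. apply Rabs_le_between in H2. apply Rabs_le_between in H3.
  assert (0 <= L1 * Rabs (y - y')) by (apply Rmult_le_pos; lra).
  assert (0 <= L2 * Rabs (x - x')) by (apply Rmult_le_pos; lra).
  assert (0 <= L1 * Rabs (x - x')) by (apply Rmult_le_pos; lra).
  assert (0 <= L2 * Rabs (y - y')) by (apply Rmult_le_pos; lra).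
  destruct i; apply Rabs_le; lra.
Qed.

(** If the slope were bounded near [0], so would be [f]; and by convexity it is
    monotone, so that it tends to minus infinity. *)
Lemma convex_singular_steep (f : R -> R) : C2_on (fun s => 0 < s) f ->
  (forall s, 0 < s -> 0 <= Derive_n f 2 s) ->
  filterlim f (at_right 0) (Rbar_locally p_infty) ->
  forall C, exists s1, 0 < s1 /\ forall s, 0 < s <= s1 -> C < f s /\ Derive f s < - C.
Proof.
  intros Hf Hc Hs C.
  assert (Hlarge : forall B, exists del, 0 < del /\ forall s, 0 < s < del -> B < f s).
  { intros B. destruct (Hs (fun r => B < r)) as [del Hdel]; [exists B; auto|].
    exists del. split; [apply cond_pos|]. intros s H. apply Hdel; [|lra].
    unfold ball; simpl; unfold AbsRing_ball, abs, minus, plus, opp; simpl.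
    apply Rabs_def1; lra. }
  destruct (Hlarge C) as [d1 [Hd1 H1]].
  destruct (Hlarge (f 1 + Rabs C)) as [d2 [Hd2 H2]].
  set (s2 := Rmin 1 d2 / 2).
  assert (Hs2 : 0 < s2 < 1 /\ s2 < d2).
  { unfold s2. pose proof (Rmin_l 1 d2). pose proof (Rmin_r 1 d2).
    assert (0 < Rmin 1 d2) by (apply Rmin_glb_lt; lra). lra. }
  assert (Hsteep : Derive f s2 < - C).
  { apply Rnot_le_lt. intros Hle. specialize (H2 s2 ltac:(lra)).
    assert (- C * (1 - s2) <= f 1 - f s2).
    { eapply mean_value_ge; [lra|..].
      - intros t Ht. apply C2_is_derive; [exact Hf|lra].
      - intros t Ht. eapply Rle_trans; [exact Hle|].
        apply convex_Derive_mono; trivial; lra. }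
    pose proof (Rle_abs C). pose proof (Rabs_pos C). nra. }
  exists (Rmin s2 (d1 / 2)). split; [apply Rmin_glb_lt; lra|].
  intros s H. pose proof (Rmin_l s2 (d1 / 2)). pose proof (Rmin_r s2 (d1 / 2)).
  split; [apply H1; lra|]. eapply Rle_lt_trans; [|exact Hsteep].
  apply convex_Derive_mono; trivial; lra.
Qed.

Lemma monotone_le_limit (u : R -> R) (l x0 : R) :
  is_lim u p_infty l -> (forall x y, x0 <= x <= y -> u x <= u y) ->
  forall x, x0 <= x -> u x <= l.
Proof.
  intros Hl Hm x Hx. apply Rnot_lt_le. intros Hlt.
  apply is_lim_spec in Hl.
  destruct (Hl (mkposreal (u x - l) ltac:(lra))) as [N HN]. simpl in HN.
  specialize (HN (Rmax N x + 1)).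
  pose proof (Rmax_l N x). pose proof (Rmax_r N x).
  specialize (HN ltac:(lra)). specialize (Hm x (Rmax N x + 1) ltac:(lra)).
  apply Rabs_def2 in HN. lra.
Qed.

Section Comparison.

Variables f g : R -> R.
Hypothesis f_pos : forall s, 0 < s -> 0 < f s.
Hypothesis g_pos : forall s, 0 < s -> 0 < g s.
Hypothesis f_derive : forall s, 0 < s -> is_derive f s (Derive f s).
Hypothesis g_derive : forall s, 0 < s -> is_derive g s (Derive g s).
Variable alpha : R.
Hypothesis alpha_le2 : alpha <= 2.
Hypothesis f_slow : forall s, 0 < s -> 0 <= s * Derive f s + alpha * f s.
Hypothesis g_fast : forall s, 0 < s -> s * Derive g s + alpha * g s <= 0.

(** The logarithmic derivatives of [f] and [g] are separated by [- alpha / s]. *)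
Lemma ratio_monotone s t : 0 < s <= t -> f s * g t <= f t * g s.
Proof.
  intros Hst.
  assert (H : 0 * (t - s) <= f t / g t - f s / g s).
  { apply (mean_value_ge (fun r => f r / g r)
      (fun r => (Derive f r * g r - f r * Derive g r) / g r ^ 2)); [lra|..].
    - intros r Hr. apply is_derive_div; [apply f_derive; lra|apply g_derive; lra|].
      pose proof (g_pos r ltac:(lra)); lra.
    - intros r Hr. pose proof (g_pos r ltac:(lra)). pose proof (f_pos r ltac:(lra)).
      apply Rdiv_le_0_compat; [|apply pow_lt; lra].
      specialize (f_slow r ltac:(lra)). specialize (g_fast r ltac:(lra)).
      apply Rmult_le_reg_l with r; [lra|]. rewrite Rmult_0_r. nra. }
  pose proof (g_pos s ltac:(lra)). pose proof (g_pos t ltac:(lra)).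
  apply Rmult_le_reg_r with (/ (g s * g t)); [apply Rinv_0_lt_compat; nra|].
  replace (f s * g t * / (g s * g t)) with (f s / g s) by (field; lra).
  replace (f t * g s * / (g s * g t)) with (f t / g t) by (field; lra). lra.
Qed.

(** The exponent 2 replaces [alpha] since [f > 0]; this avoids real powers. *)
Lemma square_times_monotone s t : 0 < s <= t -> s ^ 2 * f s <= t ^ 2 * f t.
Proof.
  intros Hst.
  assert (H : 0 * (t - s) <= t ^ 2 * f t - s ^ 2 * f s); [|lra].
  apply (mean_value_ge (fun r => r ^ 2 * f r)
    (fun r => (2 * r) * f r + r ^ 2 * Derive f r)); [lra|..].
  - intros r Hr. apply (is_derive_mult (fun r => r ^ 2) f).
    + auto_derive; [trivial|ring].
    + apply f_derive; lra.
    + intros; apply Rmult_comm.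
  - intros r Hr. specialize (f_slow r ltac:(lra)). pose proof (f_pos r ltac:(lra)).
    replace (2 * r * f r + r ^ 2 * Derive f r) with (r * (r * Derive f r + 2 * f r)) by ring.
    apply Rmult_le_pos; [lra|]. nra.
Qed.

Hypothesis f_infty : is_lim f p_infty 0.
Hypothesis g_infty : is_lim g p_infty 0.
Variable sbar : R.
Hypothesis domination : 0 < sbar /\ g sbar < f sbar.

(** Otherwise [f s - g (s - a)] is eventually nondecreasing with limit [0], so
    [f s <= g (s - a)].  With the two monotone quantities above this gives
    [rho * (s - a) ^ 2 <= s ^ 2] for all large [s], where
    [rho = f sbar / g sbar > 1]. *)
Lemma pull_beats_push_somewhere (a B : R) : 0 <= a ->
  exists M, B < M /\ a < M /\ Derive f M < Derive g (M - a).
Proof.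
  intros Ha. destruct domination as [Hsb Hdom].
  pose proof (g_pos sbar Hsb) as Hgsb.
  set (rho := f sbar / g sbar).
  assert (Hrho : 1 < rho).
  { unfold rho. apply Rmult_lt_reg_r with (g sbar); [exact Hgsb|].
    replace (f sbar / g sbar * g sbar) with (f sbar) by (field; lra). lra. }
  set (M0 := Rmax B a + sbar + 1).
  apply Classical_Prop.NNPP. intros HN.
  assert (HM0 : B < M0 /\ a + sbar < M0).
  { unfold M0. pose proof (Rmax_l B a). pose proof (Rmax_r B a). lra. }
  assert (Hall : forall s, M0 <= s -> Derive g (s - a) <= Derive f s).
  { intros s Hs. apply Rnot_lt_le. intros Hlt. apply HN. exists s.
    repeat split; lra. }
  assert (Hfg : forall s, M0 <= s -> f s <= g (s - a)).
  { intros s Hs. assert (f s - g (s - a) <= 0); [|lra].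
    apply (monotone_le_limit (fun s => f s - g (s - a)) 0 M0); [| |exact Hs].
    - replace (Finite 0) with (Rbar_minus 0 0) by (simpl; f_equal; ring).
      apply is_lim_minus'; [exact f_infty|].
      apply (is_lim_comp g (fun s => s - a) p_infty 0 p_infty g_infty).
      + eapply is_lim_minus; [apply is_lim_id|apply is_lim_const|reflexivity].
      + exists 0; intros; easy.
    - intros x y Hxy.
      assert (0 * (y - x) <= (f y - g (y - a)) - (f x - g (x - a))); [|lra].
      apply (mean_value_ge (fun s => f s - g (s - a))
        (fun s => Derive f s - Derive g (s - a))); [lra|..].
      + intros t Ht. apply (is_derive_minus f (fun s => g (s - a))).
        * apply f_derive; lra.
        * replace (Derive g (t - a)) with (1 * Derive g (t - a)) by ring.
          apply (is_derive_comp g (fun s => s - a) t (Derive g (t - a)) 1).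
          -- apply g_derive; lra.
          -- auto_derive; [trivial|ring].
      + intros t Ht. specialize (Hall t ltac:(lra)). lra. }
  assert (Hsq : forall s, M0 <= s -> rho * (s - a) ^ 2 <= s ^ 2).
  { intros s Hs. specialize (Hfg s Hs).
    pose proof (ratio_monotone sbar (s - a) ltac:(lra)) as H1.
    pose proof (square_times_monotone (s - a) s ltac:(lra)) as H2.
    pose proof (f_pos s ltac:(lra)).
    assert (H3 : rho * g (s - a) <= f (s - a)).
    { unfold rho. apply Rmult_le_reg_r with (g sbar); [exact Hgsb|].
      replace (f sbar / g sbar * g (s - a) * g sbar) with (f sbar * g (s - a)) by (field; lra).
      exact H1. }
    apply Rmult_le_reg_r with (f s); [lra|].
    eapply Rle_trans; [|exact H2].
    rewrite (Rmult_comm rho), Rmult_assoc.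
    apply Rmult_le_compat_l; [apply pow2_ge_0|]. nra. }
  (* With [s = M0 + N] the inequality would read
     [(rho - 1) * s ^ 2 + rho * a ^ 2 <= 2 * a * rho * s = (rho - 1) * N * s],
     while [s > N]. *)
  set (N := 2 * a * rho / (rho - 1)).
  assert (HN0 : 0 <= N) by (apply Rdiv_le_0_compat; nra).
  specialize (Hsq (M0 + N) ltac:(lra)).
  assert (EN : N * (rho - 1) = 2 * a * rho) by (unfold N; field; lra).
  assert (0 <= M0) by (pose proof (Rmax_r B a); lra).
  assert (0 < (M0 + N) * M0) by nra.
  nra.
Qed.

End Comparison.

(** The levels are chosen one after the other: [s0] depends on [T], then [d] on
    [s0], then [M] on both.  The first two exist since [f] and [g] are
    singular at [0]. *)
Lemma truncation_constants_exist (f g : R -> R) (T : R) : 0 < T ->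
  (forall s, 0 < s -> 0 < f s) -> (forall s, 0 < s -> 0 < g s) ->
  C2_on (fun s => 0 < s) f -> C2_on (fun s => 0 < s) g ->
  filterlim f (at_right 0) (Rbar_locally p_infty) ->
  filterlim g (at_right 0) (Rbar_locally p_infty) ->
  is_lim f p_infty 0 -> is_lim g p_infty 0 ->
  (forall s, 0 < s -> Derive g s <= 0) ->
  (forall s, 0 < s -> 0 <= Derive_n f 2 s) ->
  (forall s, 0 < s -> 0 <= Derive_n g 2 s) ->
  (exists alpha, 0 < alpha < 2 /\ forall s, 0 < s ->
      0 <= s * Derive f s + alpha * f s /\ s * Derive g s + alpha * g s <= 0) ->
  (exists s, 0 < s /\ 0 < g s < f s) ->
  exists s0 d M, 0 < s0 /\ 2 * s0 < - Derive f s0 * T ^ 2 /\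
    0 < d /\ - Derive f s0 < - Derive g d /\
    - Derive f s0 * T * (T * (2 * - Derive f s0 - Derive f (s0 / 2)))
      < g d - g (d + s0 / 2) /\
    d < M - spread (Derive f) T s0 /\ Derive f M < Derive g (M - spread (Derive f) T s0).
Proof.
  intros HT f_pos g_pos f_C2 g_C2 f_sing g_sing f_inf g_inf g'_le0 f2 g2
    [alpha [Ha Hhom]] [sbar Hsbar].
  assert (HT2 : 0 < T ^ 2) by (apply pow_lt; exact HT).
  destruct (convex_singular_steep f f_C2 f2 f_sing (2 / T ^ 2)) as [s1 [Hs1 Hf]].
  set (s0 := Rmin s1 1).
  assert (Hs0 : 0 < s0 <= s1 /\ s0 <= 1).
  { unfold s0. pose proof (Rmin_l s1 1). pose proof (Rmin_r s1 1).
    assert (0 < Rmin s1 1) by (apply Rmin_glb_lt; lra). lra. }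
  destruct (Hf s0 ltac:(lra)) as [_ Hs0'].
  set (K := - Derive f s0) in *.
  assert (HK : 2 < K * T ^ 2).
  { replace 2 with (2 / T ^ 2 * T ^ 2) by (field; lra).
    apply Rmult_lt_compat_r; unfold K; lra. }
  (* [g d > B] gives the last condition on [d] because [g] decreases. *)
  set (B := K * T * (T * (2 * K - Derive f (s0 / 2))) + g (s0 / 2)).
  destruct (convex_singular_steep g g_C2 g2 g_sing (Rmax K B)) as [d [Hd Hg]].
  destruct (Hg d ltac:(lra)) as [Hd1 Hd2].
  pose proof (Rmax_l K B). pose proof (Rmax_r K B).
  assert (Hsp : 0 <= spread (Derive f) T s0) by (unfold spread; fold K; nra).
  destruct (pull_beats_push_somewhere f g f_pos g_pos (C2_is_derive f f_C2)
    (C2_is_derive g g_C2) alpha ltac:(lra) (fun s Hs => proj1 (Hhom s Hs))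
    (fun s Hs => proj2 (Hhom s Hs)) f_inf g_inf sbar ltac:(lra)
    (spread (Derive f) T s0) (spread (Derive f) T s0 + d) Hsp) as [M [HM1 [_ HM2]]].
  exists s0, d, M. fold K.
  assert (Hgd : g (d + s0 / 2) <= g (s0 / 2)).
  { assert (g (d + s0 / 2) - g (s0 / 2) <= 0 * (d + s0 / 2 - s0 / 2)); [|lra].
    eapply mean_value_le; [lra|..].
    - intros t Ht. apply C2_is_derive; [exact g_C2|lra].
    - intros t Ht. apply g'_le0; lra. }
  unfold B in *. repeat split; try lra.
Qed.

(** * Existence of the arc *)

Lemma lipschitz_continuity_2d (u : R -> R -> R) (E : R) : 0 < E ->
  (forall a b a' b', Rabs (u a b - u a' b') <= E * (Rabs (a - a') + Rabs (b - b'))) ->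
  forall x y, continuity_2d_pt u x y.
Proof.
  intros HE Hu x y e.
  assert (He : 0 < e / (2 * E)) by (apply Rdiv_lt_0_compat; [apply cond_pos|lra]).
  exists (mkposreal _ He). simpl. intros a b Ha Hb.
  eapply Rle_lt_trans; [apply Hu|].
  replace (pos e) with (E * (e / (2 * E) + e / (2 * E))) by (field; lra).
  apply Rmult_lt_compat_l; lra.
Qed.

(** Before the collision the arc is described, up to any time [tau < T], by
    a [C^2] model on the whole line whose accelerations satisfy the equations
    on [[- tau, tau]] and which is even there; in this way the derivatives
    at time [0] are two-sided.  The inner coordinate is [q true], the outer one
    [q false]. *)
Definition arc (f g : R -> R) (T C : R) (q : bool -> R -> R) : Prop :=
  (forall tau, 0 < tau < T -> exists z v w : bool -> R -> R,
     (forall i t, is_derive (z i) t (v i t) /\ is_derive (v i) t (w i t) /\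
        continuous (w i) t) /\
     (forall i, v i 0 = 0) /\
     (forall i t, Rabs t <= tau -> q i (Rabs t) = z i t) /\
     (forall t, Rabs t <= tau ->
        w true t = Derive f (z true t) + Derive g (z false t - z true t) /\
        w false t = Derive f (z false t) - Derive g (z false t - z true t)) /\
     (forall t, 0 <= t <= tau -> Rabs (v false t) <= C * (T - t))) /\
  (forall t, 0 <= t < T -> 0 < q true t < q false t) /\
  q true T = 0 /\ 0 < q false T /\
  (forall eta, 0 < eta -> exists del, 0 < del /\
     forall t, T - del < t <= T -> 0 <= t -> Rabs (q true t) <= eta) /\
  (forall t, 0 <= t <= T -> Rabs (q false t - q false T) <= C * (T - t) ^ 2).

Section Arc.

Variables f g : R -> R.
Hypothesis f_C2 : C2_on (fun s => 0 < s) f.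
Hypothesis g_C2 : C2_on (fun s => 0 < s) g.
Hypothesis f'_le0 : forall s, 0 < s -> Derive f s <= 0.
Hypothesis g'_le0 : forall s, 0 < s -> Derive g s <= 0.
Hypothesis f''_ge0 : forall s, 0 < s -> 0 <= Derive_n f 2 s.
Hypothesis g''_ge0 : forall s, 0 < s -> 0 <= Derive_n g 2 s.
Variables T s0 d M : R.

Let K := - Derive f s0.

Hypothesis T_pos : 0 < T.
Hypothesis s0_pos : 0 < s0.
Hypothesis s0_fall : 2 * s0 < K * T ^ 2.
Hypothesis d_pos : 0 < d.
Hypothesis d_steep : K < - Derive g d.
Hypothesis d_high :
  K * T * (T * (2 * K - Derive f (s0 / 2))) < g d - g (d + s0 / 2).
Hypothesis M_large : d < M - spread (Derive f) T s0.
Hypothesis M_pull : Derive f M < Derive g (M - spread (Derive f) T s0).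

Let frc := force (Derive f) (Derive g) s0 d M.
Let f'_mono := convex_Derive_mono f f_C2 f''_ge0.
Let g'_mono := convex_Derive_mono g g_C2 g''_ge0.

Let M_gt : s0 < M /\ d < M /\ s0 + 2 * K * T ^ 2 < M.
Proof. exact (s0_lt_M (Derive f) T s0 d M T_pos s0_pos s0_fall d_pos M_large). Qed.

Definition traj (eps a b : R) : bool -> R -> R :=
  flow (frc eps) (fun j => if j then a else b).
Definition veloc (eps a b : R) : bool -> R -> R :=
  flow_velocity (frc eps) (fun j => if j then a else b).

Lemma frc_lipschitz eps : 0 < eps <= s0 -> exists L, forall i x y x' y',
  Rabs (frc eps i x y - frc eps i x' y') <= L * (Rabs (x - x') + Rabs (y - y')).
Proof. intros He. apply force_lipschitz; trivial; lra. Qed.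

Lemma traj_0 eps a b i : 0 < eps <= s0 -> traj eps a b i 0 = if i then a else b.
Proof.
  intros He. destruct (frc_lipschitz eps He) as [L HL].
  exact (flow_initial (frc eps) L HL _ i).
Qed.

Lemma veloc_0 eps a b i : veloc eps a b i 0 = 0.
Proof. apply primitive_0. Qed.

Lemma traj_derive eps a b i t : 0 < eps <= s0 ->
  is_derive (traj eps a b i) t (veloc eps a b i t).
Proof.
  intros He. destruct (frc_lipschitz eps He) as [L HL].
  exact (is_derive_flow (frc eps) L HL _ i t).
Qed.

Lemma veloc_derive eps a b i t : 0 < eps <= s0 ->
  is_derive (veloc eps a b i) t (frc eps i (traj eps a b true t) (traj eps a b false t)).
Proof.
  intros He. destruct (frc_lipschitz eps He) as [L HL].
  exact (is_derive_flow_velocity (frc eps) L HL _ i t).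
Qed.

Lemma acceleration_continuous eps a b i t : 0 < eps <= s0 ->
  continuous (fun t => frc eps i (traj eps a b true t) (traj eps a b false t)) t.
Proof.
  intros He. destruct (frc_lipschitz eps He) as [L HL].
  apply (along_continuous (frc eps) L HL). apply (flow_continuous (frc eps) L HL).
Qed.

(** The time-reversed motion solves the same problem. *)
Lemma traj_even eps a b i t : 0 < eps <= s0 -> traj eps a b i (- t) = traj eps a b i t.
Proof.
  intros He. destruct (frc_lipschitz eps He) as [L HL].
  assert (H : forall s, 0 <= s -> traj eps a b i (- s) = traj eps a b i s).
  { intros s Hs.
    destruct (dependence_on_data (frc eps) L HL
      (fun j s => traj eps a b j (- s)) (fun j s => - veloc eps a b j (- s))
      (traj eps a b) (veloc eps a b) s) with (i := i) (t := s) as [H _]; [| | |lra|].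
    - intros j r _. split.
      + replace (- veloc eps a b j (- r)) with (-1 * veloc eps a b j (- r)) by ring.
        apply (is_derive_comp (traj eps a b j) Ropp).
        * now apply traj_derive.
        * auto_derive; [trivial|ring].
      + replace (along (frc eps) (fun j s => traj eps a b j (- s)) j r) with
          (- (-1 * frc eps j (traj eps a b true (- r)) (traj eps a b false (- r))))
          by (unfold along; ring).
        apply (is_derive_opp (fun r => veloc eps a b j (- r))).
        apply (is_derive_comp (veloc eps a b j) Ropp).
        * now apply veloc_derive.
        * auto_derive; [trivial|ring].
    - intros j r _. split; [now apply traj_derive|now apply veloc_derive].
    - intros j. rewrite Ropp_0, veloc_0. ring.
    - rewrite Ropp_0, !Rminus_diag, Rabs_R0, Rplus_0_r, Rmult_0_r in H.
      pose proof (Rabs_pos (traj eps a b i (- s) - traj eps a b i s)).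
      apply Rminus_diag_uniq. apply Rabs_eq_0. lra. }
  destruct (Rle_dec 0 t); [now apply H|].
  rewrite <- (Ropp_involutive t) at 2. symmetry. apply H; lra.
Qed.

Lemma dependence_on_positions eps : 0 < eps <= s0 ->
  exists E, 0 < E /\ forall a b a' b' i t, 0 <= t <= T ->
    Rabs (traj eps a b i t - traj eps a' b' i t) <= E * (Rabs (a - a') + Rabs (b - b')) /\
    Rabs (veloc eps a b i t - veloc eps a' b' i t) <= E * (Rabs (a - a') + Rabs (b - b')).
Proof.
  intros He. destruct (frc_lipschitz eps He) as [L HL].
  exists (exp ((2 + 4 * L ^ 2) * T)). split; [apply exp_pos|].
  intros a b a' b' i t Ht.
  pose proof (dependence_on_data (frc eps) L HL (traj eps a b) (veloc eps a b)
    (traj eps a' b') (veloc eps a' b') T) as H.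
  rewrite !traj_0 in H by exact He. apply H; [..|exact Ht].
  - intros j r _. split; [now apply traj_derive|now apply veloc_derive].
  - intros j r _. split; [now apply traj_derive|now apply veloc_derive].
  - intros j. now rewrite !veloc_0.
Qed.

(** The rectangle is [[eps, Amax] * [Bmin, Bmax]].  Released at [eps] the inner
    particle ends below [eps]; released at [Amax] it cannot fall to [eps] in
    time [T].  Released at [Bmax] the outer particle stays above [M] and at
    distance at least [M] from the inner one, so the attraction wins by
    [M_pull]; released at [Bmin] the separation stays below [d] and the
    repulsion wins by [d_steep]. *)
Lemma shooting eps : 0 < eps < s0 ->
  exists a b, traj eps a b true T = eps /\ veloc eps a b false T = 0.
Proof.
  intros He. assert (He' : 0 < eps <= s0) by lra.
  pose proof M_gt as HM.
  destruct (dependence_on_positions eps He') as [E [HE HC]].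
  pose proof (fun l x H => pull_range (Derive f) f'_mono M l x H) as Hpull.
  pose proof (fun r => push_range (Derive f) (Derive g) g'_mono g'_le0 T s0 d M T_pos s0_pos s0_fall d_pos M_large r) as Hpush.
  pose proof (phi_M_neg (Derive f) (Derive g) g'_le0 T s0 d M d_pos M_large M_pull) as HphiM.
  assert (Hfx : forall x y, Derive f eps + Derive g d <= frc eps true x y <= Derive f M).
  { intros x y. unfold frc, force. pose proof (Hpull eps x ltac:(lra)).
    pose proof (Hpush (y - x)). lra. }
  assert (Hfy : forall x y, - K <= frc eps false x y <= - Derive g d).
  { intros x y. unfold frc, force. pose proof (Hpull s0 y ltac:(lra)).
    pose proof (Hpush (y - x)). unfold K; lra. }
  (* [C1] bounds the acceleration of the inner particle; it depends on [eps], and so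
     does the rectangle. *)
  set (C1 := - (Derive f eps + Derive g d)).
  assert (HC1 : 0 <= C1) by (specialize (Hfx 0 0); unfold C1; lra).
  assert (HK : 0 < K) by exact (K_pos (Derive f) T s0 T_pos s0_pos s0_fall).
  assert (HT2 : 0 < T ^ 2) by (apply pow_lt; exact T_pos).
  set (Amax := eps + C1 * T ^ 2).
  set (Bmin := - (C1 - Derive g d) * T ^ 2).
  set (Bmax := M + Amax + K * T ^ 2).
  assert (HA : eps <= Amax) by (unfold Amax; nra).
  assert (HB : Bmin <= 0 /\ 0 <= Bmax).
  { unfold Bmin, Bmax, Amax. split; nra. }
  assert (Hx : forall a b t, 0 <= t <= T ->
     a - C1 * t ^ 2 / 2 <= traj eps a b true t <= a + Derive f M * t ^ 2 / 2).
  { intros a b t Ht. split.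
    - destruct (motion_from_rest_ge (traj eps a b true) (veloc eps a b true)
        (fun t => frc eps true (traj eps a b true t) (traj eps a b false t))
        (- C1) t) as [_ H]; [lra|intros; now apply traj_derive|intros; now apply veloc_derive
        |apply veloc_0|intros; unfold C1; rewrite Ropp_involutive; apply Hfx|].
      rewrite traj_0 in H by exact He'. lra.
    - destruct (motion_from_rest_le (traj eps a b true) (veloc eps a b true)
        (fun t => frc eps true (traj eps a b true t) (traj eps a b false t))
        (Derive f M) t) as [_ H]; [lra|intros; now apply traj_derive|intros; now apply veloc_derive
        |apply veloc_0|intros; apply Hfx|].
      rewrite traj_0 in H by exact He'. lra. }
  assert (Hy : forall a b t, 0 <= t <= T ->
     b - K * t ^ 2 / 2 <= traj eps a b false t <= b - Derive g d * t ^ 2 / 2).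
  { intros a b t Ht. split.
    - destruct (motion_from_rest_ge (traj eps a b false) (veloc eps a b false)
        (fun t => frc eps false (traj eps a b true t) (traj eps a b false t))
        (- K) t) as [_ H]; [lra|intros; now apply traj_derive|intros; now apply veloc_derive
        |apply veloc_0|intros; apply Hfy|].
      rewrite traj_0 in H by exact He'. lra.
    - destruct (motion_from_rest_le (traj eps a b false) (veloc eps a b false)
        (fun t => frc eps false (traj eps a b true t) (traj eps a b false t))
        (- Derive g d) t) as [_ H]; [lra|intros; now apply traj_derive|intros; now apply veloc_derive
        |apply veloc_0|intros; apply Hfy|].
      rewrite traj_0 in H by exact He'. lra. }
  assert (Hsq : forall t, 0 <= t <= T -> 0 <= t ^ 2 <= T ^ 2).
  { intros t Ht. split; [apply pow2_ge_0|]. apply pow_incr; lra. }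
  destruct (poincare_miranda (fun a b => traj eps a b true T - eps)
    (fun a b => veloc eps a b false T) eps Amax Bmin Bmax) as [a [b [_ [_ [H1 H2]]]]].
  - exact HA.
  - lra.
  - apply (lipschitz_continuity_2d _ E HE). intros a b a' b'.
    replace (_ - _) with (traj eps a b true T - traj eps a' b' true T) by ring.
    apply HC; lra.
  - apply (lipschitz_continuity_2d _ E HE). intros a b a' b'. apply HC; lra.
  - intros b _. specialize (Hx eps b T ltac:(lra)). nra.
  - intros b _. specialize (Hx Amax b T ltac:(lra)). unfold Amax in *. nra.
  - intros a Ha.
    assert (H : veloc eps a Bmax false T - veloc eps a Bmax false 0 <=
       (Derive f M - Derive g (M - spread (Derive f) T s0)) * (T - 0)).
    { eapply mean_value_le; [lra|intros; now apply veloc_derive|].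
      intros t Ht. specialize (Hsq t Ht).
      specialize (Hx a Bmax t Ht). specialize (Hy a Bmax t Ht).
      assert (K * t ^ 2 <= K * T ^ 2) by (apply Rmult_le_compat_l; lra).
      assert (Derive f M * t ^ 2 <= 0) by nra.
      assert (Hr : M <= traj eps a Bmax false t - traj eps a Bmax true t).
      { unfold Bmax in *. lra. }
      unfold frc, force. pose proof (Hpull s0 (traj eps a Bmax false t) ltac:(lra)).
      unfold push. rewrite (clamp_above d M _) by lra.
      assert (Derive g (M - spread (Derive f) T s0) <= Derive g M).
      { apply g'_mono. split; [lra|]. unfold spread. fold K. nra. }
      lra. }
    rewrite veloc_0 in H. nra.
  - intros a Ha.
    assert (H : 0 * (T - 0) <= veloc eps a Bmin false T - veloc eps a Bmin false 0).
    { eapply mean_value_ge; [lra|intros; now apply veloc_derive|].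
      intros t Ht. specialize (Hsq t Ht).
      specialize (Hx a Bmin t Ht). specialize (Hy a Bmin t Ht).
      assert (C1 * t ^ 2 <= C1 * T ^ 2) by (apply Rmult_le_compat_l; lra).
      assert (- Derive g d * t ^ 2 <= - Derive g d * T ^ 2)
        by (apply Rmult_le_compat_l; lra).
      assert (0 <= C1 * t ^ 2) by (apply Rmult_le_pos; lra).
      assert (0 <= - Derive g d * t ^ 2) by (apply Rmult_le_pos; lra).
      assert (Hr : traj eps a Bmin false t - traj eps a Bmin true t <= d).
      { unfold Bmin in *. lra. }
      unfold frc, force. pose proof (Hpull s0 (traj eps a Bmin false t) ltac:(lra)).
      unfold push. rewrite (clamp_below d M _) by lra. unfold K in *; lra. }
    rewrite veloc_0 in H. lra.
  - exists a, b. split; [lra|exact H2].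
Qed.

(** The truncated boundary value problem at height [eps]. *)
Definition hits (eps a b : R) : Prop :=
  traj eps a b true T = eps /\ veloc eps a b false T = 0.

Lemma hits_bounds eps a b t : 0 < eps < s0 -> hits eps a b -> 0 <= t <= T ->
  eps <= traj eps a b true t <= M /\ s0 * (1 - t / T) <= traj eps a b true t /\
  s0 <= traj eps a b false t <= M /\
  d <= traj eps a b false t - traj eps a b true t <= M /\
  0 <= veloc eps a b false t <= K * (T - t) /\
  (forall eta, eps <= eta <= M ->
     traj eps a b true t <= eta + T * (K - Derive f eta) * (T - t)).
Proof.
  intros He [H1 H2] Ht. assert (He' : 0 < eps <= s0) by lra.
  assert (g_der : forall s, 0 < s -> is_derive g s (Derive g s))
    by exact (C2_is_derive g g_C2).
  apply (a_priori_bounds (Derive f) (Derive g) g f'_mono f'_le0 g'_mono g'_le0 g_der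
    T s0 d M T_pos s0_pos s0_fall d_pos d_steep d_high M_large M_pull eps
    (traj eps a b true) (traj eps a b false) (veloc eps a b true) (veloc eps a b false));
  trivial; intros; try (now apply traj_derive); try (now apply veloc_derive); apply veloc_0.
Qed.

(** At times when concavity keeps the inner particle above [eta], truncation at
    [eps] and at [eta] give the same force along the trajectory. *)
Lemma truncation_inactive eps eta a b i t :
  0 < eps < s0 -> eps <= eta <= s0 -> hits eps a b -> 0 <= t <= T ->
  eta <= s0 * (1 - t / T) ->
  traj eps a b i t = traj eta a b i t /\ veloc eps a b i t = veloc eta a b i t.
Proof.
  intros He Heta Hh Ht Hlow. pose proof M_gt as HM.
  assert (Heta' : 0 < eta <= s0) by lra. assert (He' : 0 < eps <= s0) by lra.
  destruct (frc_lipschitz eta Heta') as [L HL].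
  pose proof (dependence_on_data (frc eta) L HL (traj eps a b) (veloc eps a b)
    (traj eta a b) (veloc eta a b) t) as H.
  rewrite !traj_0, !Rminus_diag, Rabs_R0, Rplus_0_r, Rmult_0_r in H by lra.
  assert (forall r, Rabs r <= 0 -> r = 0).
  { intros r Hr. pose proof (Rabs_pos r). apply Rabs_eq_0. lra. }
  destruct H with (i := i) (t := t) as [H1 H2]; [..|lra|].
  - intros j r Hr. split; [now apply traj_derive|].
    replace (along (frc eta) (traj eps a b) j r) with
      (frc eps j (traj eps a b true r) (traj eps a b false r)); [now apply veloc_derive|].
    destruct (hits_bounds eps a b r He Hh ltac:(lra)) as [B1 [B2 _]].
    assert (Hr' : s0 * (1 - t / T) <= s0 * (1 - r / T)).
    { apply Rmult_le_compat_l; [lra|]. unfold Rdiv.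
      assert (r * / T <= t * / T); [|lra].
      apply Rmult_le_compat_r; [left; apply Rinv_0_lt_compat; lra|lra]. }
    unfold along, frc, force. destruct j; [|reflexivity].
    unfold pull. rewrite !clamp_id by lra. reflexivity.
  - intros j r Hr. split; [now apply traj_derive|now apply veloc_derive].
  - intros j. now rewrite !veloc_0.
  - split; apply Rminus_diag_uniq; auto.
Qed.

Let e (n : nat) : R := s0 / (INR n + 2).

Lemma e_range n : 0 < e n < s0.
Proof.
  unfold e. pose proof (pos_INR n). split; [apply Rdiv_lt_0_compat; lra|].
  apply Rmult_lt_reg_r with (INR n + 2); [lra|].
  unfold Rdiv. rewrite Rmult_assoc, Rinv_l by lra. nra.
Qed.

Lemma e_limit : is_lim_seq e 0.
Proof.
  unfold e. replace (Finite 0) with (Rbar_mult s0 (Finite 0)) by (simpl; f_equal; ring).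
  apply is_lim_seq_scal_l. apply (is_lim_seq_inv _ p_infty); [|easy].
  apply (is_lim_seq_plus _ _ p_infty 2); [apply is_lim_seq_INR|apply is_lim_seq_const|reflexivity].
Qed.

Lemma converging_shots : exists (eps a b : nat -> R) (a0 b0 c0 : R),
  (forall n, 0 < eps n < s0 /\ hits (eps n) (a n) (b n)) /\
  is_lim_seq eps 0 /\ is_lim_seq a a0 /\ is_lim_seq b b0 /\
  is_lim_seq (fun n => traj (eps n) (a n) (b n) false T) c0.
Proof.
  assert (H : forall n, exists ab : R * R, hits (e n) (fst ab) (snd ab)).
  { intros n. destruct (shooting (e n) (e_range n)) as [a [b Hab]].
    now exists (a, b). }
  apply functional_choice in H. destruct H as [ab Hab].
  assert (Hb : forall n t, 0 <= t <= T -> _) by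
    (intros n t Ht; exact (hits_bounds (e n) _ _ t (e_range n) (Hab n) Ht)).
  assert (H0 : 0 <= 0 <= T) by lra. assert (HT : 0 <= T <= T) by lra.
  pose proof (fun n => e_range n) as He.
  (* Three successive extractions; the outer position at time [T] is not covered by
     the continuity of the truncated flows. *)
  destruct (bounded_subsequence (fun n => fst (ab n)) 0 M) as [p1 [a0 [Hp1 L1]]].
  { intros n. pose proof (Hb n 0 H0) as B. rewrite !traj_0 in B by (specialize (He n); lra).
    specialize (He n). lra. }
  destruct (bounded_subsequence (fun n => snd (ab (p1 n))) 0 M) as [p2 [b0 [Hp2 L2]]].
  { intros n. pose proof (Hb (p1 n) 0 H0) as B.
    rewrite !traj_0 in B by (specialize (He (p1 n)); lra). lra. }
  destruct (bounded_subsequence (fun n => traj (e (p1 (p2 n))) (fst (ab (p1 (p2 n))))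
     (snd (ab (p1 (p2 n)))) false T) 0 M) as [p3 [c0 [Hp3 L3]]].
  { intros n. pose proof (Hb (p1 (p2 n)) T HT) as B. lra. }
  exists (fun n => e (p1 (p2 (p3 n)))), (fun n => fst (ab (p1 (p2 (p3 n))))),
    (fun n => snd (ab (p1 (p2 (p3 n))))), a0, b0, c0.
  repeat split; try apply He; try apply Hab.
  - apply (is_lim_seq_subseq_ge (fun n => e (p1 (p2 n)))); [exact Hp3|].
    apply (is_lim_seq_subseq_ge (fun n => e (p1 n))); [exact Hp2|].
    apply is_lim_seq_subseq_ge; [exact Hp1|exact e_limit].
  - apply (is_lim_seq_subseq_ge (fun n => fst (ab (p1 (p2 n))))); [exact Hp3|].
    apply (is_lim_seq_subseq_ge (fun n => fst (ab (p1 n)))); [exact Hp2|exact L1].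
  - apply (is_lim_seq_subseq_ge (fun n => snd (ab (p1 (p2 n))))); [exact Hp3|exact L2].
  - exact L3.
Qed.

(** As long as the inner particle is above [eta], all but finitely many shots follow
    the fixed flow truncated at [eta], which is continuous in the initial
    positions. *)
Lemma shots_converge (eps a b : nat -> R) (a0 b0 eta t : R) (i : bool) :
  (forall n, 0 < eps n < s0 /\ hits (eps n) (a n) (b n)) ->
  is_lim_seq eps 0 -> is_lim_seq a a0 -> is_lim_seq b b0 ->
  0 < eta <= s0 -> 0 <= t <= T -> eta <= s0 * (1 - t / T) ->
  is_lim_seq (fun n => traj (eps n) (a n) (b n) i t) (traj eta a0 b0 i t) /\
  is_lim_seq (fun n => veloc (eps n) (a n) (b n) i t) (veloc eta a0 b0 i t).
Proof.
  intros Hh He Ha Hb Heta Ht Hlow.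
  destruct (dependence_on_positions eta Heta) as [E [HE HC]].
  assert (Hev : eventually (fun n => eps n <= eta)).
  { apply is_lim_seq_spec in He. destruct (He (mkposreal eta (proj1 Heta))) as [N HN].
    exists N. intros n Hn. specialize (HN n Hn). simpl in HN. apply Rabs_def2 in HN. lra. }
  assert (HS : is_lim_seq (fun n => E * (Rabs (a n - a0) + Rabs (b n - b0))) 0).
  { replace (Finite 0) with (Finite (E * (Rabs (a0 - a0) + Rabs (b0 - b0)))).
    2: { rewrite !Rminus_diag, Rabs_R0. f_equal; ring. }
    apply (is_lim_seq_scal_l _ E (Finite _)). apply is_lim_seq_plus';
    [apply (is_lim_seq_abs _ (Finite (a0 - a0)))|apply (is_lim_seq_abs _ (Finite (b0 - b0)))];
    (apply is_lim_seq_minus'; [assumption|apply is_lim_seq_const]). }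
  assert (Hgen : forall (u : nat -> R) l,
    eventually (fun n => Rabs (u n - l) <= E * (Rabs (a n - a0) + Rabs (b n - b0))) ->
    is_lim_seq u l).
  { intros u l Hu. apply is_lim_seq_spec. intros r.
    apply is_lim_seq_spec in HS. generalize (filter_and _ _ Hu (HS r)).
    apply filter_imp. intros n [H1 H2]. rewrite Rminus_0_r in H2.
    apply Rabs_def2 in H2. lra. }
  split; apply Hgen; revert Hev; apply filter_imp; intros n Hn;
    destruct (Hh n) as [Hen Hhn];
    destruct (truncation_inactive (eps n) eta (a n) (b n) i t Hen ltac:(lra) Hhn Ht Hlow)
      as [E1 E2].
  - rewrite E1. now apply HC.
  - rewrite E2. now apply HC.
Qed.

(** At time [t] the limit of the shots is the flow truncated at any level
    below [s0 * (1 - t / T)], half of which is used to define the arc. *)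
Lemma arc_exists : exists q, arc f g T K q.
Proof.
  destruct converging_shots as [eps [a [b [a0 [b0 [c0 [Hh [Le [La [Lb Lc]]]]]]]]]].
  pose proof M_gt as HM.
  set (lev := fun t => s0 * (1 - t / T) / 2).
  assert (Hlev : forall t, 0 <= t < T -> 0 < lev t <= s0 /\ lev t <= s0 * (1 - t / T)).
  { intros t Ht. unfold lev.
    assert (0 < 1 - t / T <= 1).
    { assert (0 <= t / T) by (apply Rdiv_le_0_compat; lra).
      split; [|lra]. apply Rmult_lt_reg_r with T; [lra|].
      replace ((1 - t / T) * T) with (T - t) by (field; lra). lra. }
    nra. }
  set (q := fun (i : bool) t =>
    if Rlt_dec t T then traj (lev t) a0 b0 i t else if i then 0 else c0).
  assert (Hlim : forall i t, 0 <= t < T ->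
    is_lim_seq (fun n => traj (eps n) (a n) (b n) i t) (q i t)).
  { intros i t Ht. unfold q. destruct (Rlt_dec t T); [|lra].
    destruct (Hlev t Ht). apply shots_converge; trivial; lra. }
  assert (Hmodel : forall eta i t, 0 < eta <= s0 -> 0 <= t < T -> eta <= s0 * (1 - t / T) ->
    q i t = traj eta a0 b0 i t).
  { intros eta i t Heta Ht Hl.
    destruct (shots_converge eps a b a0 b0 eta t i Hh Le La Lb Heta ltac:(lra) Hl) as [H1 _].
    pose proof (Hlim i t Ht) as H2.
    apply is_lim_seq_unique in H1. apply is_lim_seq_unique in H2.
    rewrite H1 in H2. now injection H2. }
  assert (Hbnd : forall n t, 0 <= t <= T -> _) by
    (intros n t Ht; exact (hits_bounds (eps n) _ _ t (proj1 (Hh n)) (proj2 (Hh n)) Ht)).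
  assert (HqT : q true T = 0 /\ q false T = c0).
  { unfold q. destruct (Rlt_dec T T); [lra|auto]. }
  assert (Hle : forall (u : nat -> R) (l m : R), is_lim_seq u l -> (forall n, m <= u n) -> m <= l).
  { intros u l m Hu Hm. exact (is_lim_seq_le _ _ (Finite m) (Finite l) Hm (is_lim_seq_const m) Hu). }
  assert (Hge : forall (u : nat -> R) (l m : R), is_lim_seq u l -> (forall n, u n <= m) -> l <= m).
  { intros u l m Hu Hm. exact (is_lim_seq_le _ _ (Finite l) (Finite m) Hm Hu (is_lim_seq_const m)). }
  assert (Hq : forall t, 0 <= t < T -> s0 * (1 - t / T) <= q true t <= M /\
     s0 <= q false t <= M /\ d <= q false t - q true t <= M).
  { intros t Ht. pose proof (Hlim true t Ht) as L1. pose proof (Hlim false t Ht) as L2.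
    pose proof (is_lim_seq_minus' _ _ _ _ L2 L1) as L3.
    assert (HB : forall n, _) by (intros n; exact (Hbnd n t ltac:(lra))).
    repeat split;
    (eapply Hle; [eassumption|intros n; specialize (HB n); simpl; lra]) ||
    (eapply Hge; [eassumption|intros n; specialize (HB n); simpl; lra]). }
  exists q. split; [|split; [|split; [|split; [|split]]]].
  - intros tau Htau. destruct (Hlev tau ltac:(lra)) as [He1 He2].
    set (eta := lev tau) in *.
    assert (Hmon : forall t, 0 <= t <= tau -> eta <= s0 * (1 - t / T)).
    { intros t Ht. eapply Rle_trans; [exact He2|]. apply Rmult_le_compat_l; [lra|].
      assert (t * / T <= tau * / T); [|unfold Rdiv; lra].
      apply Rmult_le_compat_r; [left; apply Rinv_0_lt_compat; lra|lra]. }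
    assert (Hz : forall i t, Rabs t <= tau -> q i (Rabs t) = traj eta a0 b0 i t).
    { intros i t Ht. pose proof (Rabs_pos t).
      rewrite (Hmodel eta) by (trivial; try apply Hmon; lra).
      unfold Rabs. destruct (Rcase_abs t); [now apply traj_even|reflexivity]. }
    (* The model up to time [tau] is the flow truncated at the level [lev tau]. *)
    exists (traj eta a0 b0), (veloc eta a0 b0),
      (fun i t => frc eta i (traj eta a0 b0 true t) (traj eta a0 b0 false t)).
    repeat apply conj.
    + intros i t. split; [now apply traj_derive|split; [now apply veloc_derive|]].
      now apply acceleration_continuous.
    + intros i. apply veloc_0.
    + exact Hz.
    + intros t Ht. pose proof (Rabs_pos t). cbv beta. rewrite <- !Hz by exact Ht.
      destruct (Hq (Rabs t) ltac:(lra)) as [Q1 [Q2 Q3]].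
      specialize (Hmon (Rabs t) ltac:(lra)).
      unfold frc, force, pull, push.
      rewrite !clamp_id by lra. split; reflexivity.
    + intros t Ht. specialize (Hmon t Ht).
      destruct (shots_converge eps a b a0 b0 eta t false Hh Le La Lb He1 ltac:(lra) Hmon) as [_ Lv].
      assert (HB : forall n, _) by (intros n; exact (Hbnd n t ltac:(lra))).
      assert (0 <= veloc eta a0 b0 false t)
        by (eapply Hle; [exact Lv|intros n; specialize (HB n); simpl; lra]).
      assert (veloc eta a0 b0 false t <= K * (T - t))
        by (eapply Hge; [exact Lv|intros n; specialize (HB n); simpl; lra]).
      apply Rabs_le; lra.
  - intros t Ht. destruct (Hq t Ht). destruct (Hlev t Ht). lra.
  - apply HqT.
  - rewrite (proj2 HqT). apply Rlt_le_trans with s0; [exact s0_pos|].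
    eapply Hle; [exact Lc|]. intros n. pose proof (Hbnd n T ltac:(lra)). simpl; lra.
  - intros eta Heta. set (m := Rmin (eta / 2) s0).
    assert (Hm : 0 < m <= s0 /\ m <= eta / 2).
    { unfold m. pose proof (Rmin_l (eta / 2) s0). pose proof (Rmin_r (eta / 2) s0).
      assert (0 < Rmin (eta / 2) s0) by (apply Rmin_glb_lt; lra). lra. }
    set (S := T * (K - Derive f m) + 1).
    assert (HS : 0 < S).
    { unfold S. pose proof (f'_le0 m ltac:(lra)).
      assert (HK : 0 < K) by exact (K_pos (Derive f) T s0 T_pos s0_pos s0_fall). nra. }
    exists (eta / 2 / S). split; [apply Rdiv_lt_0_compat; lra|].
    intros t Ht Ht0.
    destruct (Req_dec t T) as [->|Hne]; [rewrite (proj1 HqT), Rabs_R0; lra|].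
    destruct (Hq t ltac:(lra)) as [Q1 _]. destruct (Hlev t ltac:(lra)).
    rewrite Rabs_right by lra.
    assert (q true t <= m + S * (T - t)).
    { apply (is_lim_seq_le_loc (fun n => traj (eps n) (a n) (b n) true t)
        (fun _ => m + S * (T - t)) (Finite _) (Finite _)) with (3 := is_lim_seq_const _);
      [|apply Hlim; lra].
      apply is_lim_seq_spec in Le. destruct (Le (mkposreal m (proj1 (proj1 Hm)))) as [N HN].
      exists N. intros n Hn. specialize (HN n Hn). simpl in HN. apply Rabs_def2 in HN.
      destruct (Hbnd n t ltac:(lra)) as [_ [_ [_ [_ [_ HB]]]]].
      specialize (HB m ltac:(lra)). unfold S. nra. }
    assert (S * (T - t) <= eta / 2); [|lra].
    apply Rmult_le_reg_r with (/ S); [now apply Rinv_0_lt_compat|].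
    replace (S * (T - t) * / S) with (T - t) by (field; lra).
    unfold Rdiv in *. lra.
  - intros t Ht. rewrite (proj2 HqT).
    destruct (Req_dec t T) as [->|Hne].
    { rewrite (proj2 HqT), !Rminus_diag, Rabs_R0. simpl; lra. }
    assert (HL : is_lim_seq (fun n => Rabs (traj (eps n) (a n) (b n) false t -
       traj (eps n) (a n) (b n) false T)) (Rabs (q false t - c0))).
    { apply (is_lim_seq_abs _ (Finite (q false t - c0))).
      apply is_lim_seq_minus'; [apply Hlim; lra|exact Lc]. }
    eapply Hge; [exact HL|]. intros n. simpl.
    destruct (Hh n) as [Hen _].
    assert (HK : 0 < K) by exact (K_pos (Derive f) T s0 T_pos s0_pos s0_fall).
    assert (U : traj (eps n) (a n) (b n) false T - traj (eps n) (a n) (b n) false t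
      <= (K * (T - t)) * (T - t)).
    { eapply mean_value_le; [lra|intros; apply traj_derive; lra|].
      intros r Hr. pose proof (Hbnd n r ltac:(lra)).
      assert (K * (T - r) <= K * (T - t)) by (apply Rmult_le_compat_l; lra). lra. }
    assert (D : 0 * (T - t) <= traj (eps n) (a n) (b n) false T - traj (eps n) (a n) (b n) false t).
    { eapply mean_value_ge; [lra|intros; apply traj_derive; lra|].
      intros r Hr. pose proof (Hbnd n r ltac:(lra)). lra. }
    rewrite Rabs_left1 by lra. nra.
Qed.

End Arc.

(** * Reflection and periodic extension *)

Lemma periodic_shift {X : Type} (u : R -> X) (P : R) :
  (forall t, u (t + P) = u t) -> forall (k : Z) t, u (t + IZR k * P) = u t.
Proof.
  intros Hu.
  assert (Hn : forall (n : nat) t, u (t + INR n * P) = u t).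
  { induction n as [|n IH]; intros t; [f_equal; simpl; ring|].
    rewrite S_INR, <- (IH t), <- (Hu (t + INR n * P)). f_equal; ring. }
  intros k t. destruct (Z_le_dec 0 k) as [Hk|Hk].
  - rewrite <- (Z2Nat.id k Hk), <- INR_IZR_INZ. apply Hn.
  - rewrite <- (Hn (Z.to_nat (- k)) (t + IZR k * P)), INR_IZR_INZ, Z2Nat.id by lia.
    rewrite opp_IZR. f_equal; ring.
Qed.

Section Extension.

Variable T : R.
Hypothesis T_pos : 0 < T.

(** The even, [2 * T]-periodic function equal to the identity on [[0, T]] (a
    triangle wave); with the cosine both symmetries come for free. *)
Definition fold (t : R) : R := T / PI * acos (cos (PI / T * t)).

Lemma fold_id t : 0 <= t <= T -> fold t = t.
Proof.
  intros Ht. pose proof PI_RGT_0. unfold fold. rewrite acos_cos; [field; lra|].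
  assert (0 <= PI / T) by (apply Rdiv_le_0_compat; lra).
  split; [nra|]. apply Rle_trans with (PI / T * T); [nra|right; field; lra].
Qed.

Lemma fold_even t : fold (- t) = fold t.
Proof.
  unfold fold. replace (PI / T * - t) with (- (PI / T * t)) by ring. now rewrite cos_neg.
Qed.

Lemma fold_periodic t : fold (t + 2 * T) = fold t.
Proof.
  unfold fold. do 2 f_equal.
  replace (PI / T * (t + 2 * T)) with (PI / T * t + 2 * INR 1 * PI) by (simpl; field; lra).
  apply cos_period.
Qed.

Lemma fold_abs t : - T <= t <= T -> fold t = Rabs t.
Proof.
  intros Ht. destruct (Rle_dec 0 t).
  - rewrite Rabs_right by lra. apply fold_id; lra.
  - rewrite Rabs_left, <- fold_even by lra. apply fold_id; lra.
Qed.

Lemma fold_reflect t : fold (2 * T - t) = fold t.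
Proof.
  replace (2 * T - t) with (- t + 2 * T) by ring. now rewrite fold_periodic, fold_even.
Qed.

Lemma fold_near_T t : 0 <= t <= 2 * T -> fold t = T - Rabs (t - T).
Proof.
  intros Ht. destruct (Rle_dec t T).
  - rewrite Rabs_left1, fold_id by lra. ring.
  - rewrite Rabs_right, <- fold_reflect, fold_id by lra. ring.
Qed.

Lemma fold_shift k t : fold (t + IZR k * (2 * T)) = fold t.
Proof. apply periodic_shift, fold_periodic. Qed.

Lemma near_multiple t : exists k : Z, - T <= t - IZR k * (2 * T) < T.
Proof.
  destruct (base_Int_part ((t + T) / (2 * T))) as [H1 H2].
  exists (Int_part ((t + T) / (2 * T))).
  set (k := IZR (Int_part ((t + T) / (2 * T)))) in *.
  assert (E : t + T = (t + T) / (2 * T) * (2 * T)) by (field; lra).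
  assert (k * (2 * T) <= (t + T) / (2 * T) * (2 * T)) by (apply Rmult_le_compat_r; lra).
  assert ((t + T) / (2 * T) * (2 * T) < (k + 1) * (2 * T)) by (apply Rmult_lt_compat_r; lra).
  lra.
Qed.

Lemma fold_range t : 0 <= fold t <= T.
Proof.
  destruct (near_multiple t) as [k Hk].
  replace t with (t - IZR k * (2 * T) + IZR k * (2 * T)) by ring.
  rewrite fold_shift, fold_abs by lra. split; [apply Rabs_pos|].
  apply Rabs_le; lra.
Qed.

Lemma fold_eq_T t : fold t = T -> exists k : Z, t = T + IZR k * (2 * T).
Proof.
  intros H. destruct (near_multiple t) as [k Hk].
  replace t with (t - IZR k * (2 * T) + IZR k * (2 * T)) in H by ring.
  rewrite fold_shift, fold_abs in H by lra.
  (* [near_multiple] uses [[- T, T)], so the odd multiple is represented by [- T]. *)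
  exists (k - 1)%Z. rewrite minus_IZR.
  destruct (Rle_dec 0 (t - IZR k * (2 * T))).
  - rewrite Rabs_right in H; lra.
  - rewrite Rabs_left in H; lra.
Qed.

Lemma fold_near_odd_multiple k t : Rabs (t - (T + IZR k * (2 * T))) <= T ->
  fold t = T - Rabs (t - (T + IZR k * (2 * T))).
Proof.
  intros H. apply Rabs_le_between in H.
  replace t with (t - IZR k * (2 * T) + IZR k * (2 * T)) at 1 by ring.
  rewrite fold_shift, fold_near_T by lra. do 2 f_equal; ring.
Qed.

End Extension.

(** All that is needed of the extended orbit at a point is that it coincides
    nearby with a translate of a [C^2] function. *)
Lemma local_model_C2 (u z v w : R -> R) (c t0 : R) :
  (forall t, is_derive z t (v t) /\ is_derive v t (w t) /\ continuous w t) ->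
  locally t0 (fun t => u t = z (t - c)) ->
  is_derive u t0 (v (t0 - c)) /\ locally t0 (fun t => Derive u t = v (t - c)) /\
  ex_derive (Derive u) t0 /\ continuous (Derive_n u 2) t0 /\
  Derive_n u 2 t0 = w (t0 - c).
Proof.
  intros Hz Hu.
  assert (Hshift : forall (y y' : R -> R) t, (forall s, is_derive y s (y' s)) ->
     is_derive (fun t => y (t - c)) t (y' (t - c))).
  { intros y y' t Hy. replace (y' (t - c)) with (1 * y' (t - c)) by ring.
    apply (is_derive_comp y (fun t => t - c)); [apply Hy|].
    auto_derive; [trivial|ring]. }
  assert (H1 : locally t0 (fun t => is_derive u t (v (t - c)))).
  { apply locally_locally in Hu. revert Hu. apply filter_imp. intros t Ht.
    apply (is_derive_ext_loc (fun t => z (t - c))).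
    - revert Ht. apply filter_imp. intros s Hs; now symmetry.
    - apply Hshift. apply Hz. }
  assert (H2 : locally t0 (fun t => Derive u t = v (t - c))).
  { revert H1. apply filter_imp. intros t Ht. now apply is_derive_unique. }
  assert (H3 : locally t0 (fun t => is_derive (Derive u) t (w (t - c)))).
  { apply locally_locally in H2. revert H2. apply filter_imp. intros t Ht.
    apply (is_derive_ext_loc (fun t => v (t - c))).
    - revert Ht. apply filter_imp. intros s Hs; now symmetry.
    - apply Hshift. apply Hz. }
  assert (H4 : locally t0 (fun t => Derive_n u 2 t = w (t - c))).
  { revert H3. apply filter_imp. intros t Ht. now apply is_derive_unique. }
  split; [exact (locally_singleton _ _ H1)|]. split; [exact H2|].
  split; [eexists; exact (locally_singleton _ _ H3)|].
  split; [|exact (locally_singleton _ _ H4)].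
  apply (continuous_ext_loc _ (fun t => w (t - c))).
  - revert H4. apply filter_imp. intros s Hs; now symmetry.
  - apply (continuous_comp (fun t => t - c) w); [|apply Hz].
    apply (is_derive_continuous _ _ 1). auto_derive; [trivial|ring].
Qed.

Lemma continuous_R (u : R -> R) (t : R) :
  (forall eps, 0 < eps -> exists del, 0 < del /\
     forall s, Rabs (s - t) < del -> Rabs (u s - u t) <= eps) -> continuous u t.
Proof.
  intros H. apply filterlim_locally. intros eps.
  destruct (H (eps / 2)) as [del [Hdel Hs]]; [pose proof (cond_pos eps); lra|].
  exists (mkposreal del Hdel). intros s Hball.
  specialize (Hs s Hball). pose proof (cond_pos eps).
  unfold ball; simpl; unfold AbsRing_ball, abs, minus, plus, opp; simpl.
  change (Rabs (u s - u t) < eps). lra.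
Qed.

Lemma is_derive_flat (u : R -> R) (t C : R) : 0 <= C ->
  locally t (fun s => Rabs (u s - u t) <= C * (s - t) ^ 2) -> is_derive u t 0.
Proof.
  intros HC [r Hr]. apply is_derive_Reals. intros eps Heps.
  assert (Hd : 0 < Rmin r (eps / (C + 1))).
  { apply Rmin_glb_lt; [apply cond_pos|]. apply Rdiv_lt_0_compat; lra. }
  exists (mkposreal _ Hd). simpl. intros h Hh0 Hh.
  pose proof (Rmin_l r (eps / (C + 1))). pose proof (Rmin_r r (eps / (C + 1))).
  specialize (Hr (t + h)).
  assert (Hb : ball t r (t + h)).
  { unfold ball; simpl; unfold AbsRing_ball, abs, minus, plus, opp; simpl.
    replace (t + h + - t) with h by ring. lra. }
  specialize (Hr Hb). replace (t + h - t) with h in Hr by ring.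
  rewrite Rminus_0_r. unfold Rdiv. rewrite Rabs_mult, Rabs_inv.
  pose proof (Rabs_pos_lt h Hh0) as Hpos.
  rewrite <- pow2_abs in Hr.
  apply Rle_lt_trans with (C * Rabs h).
  - apply Rmult_le_reg_r with (Rabs h); [exact Hpos|].
    rewrite Rmult_assoc, Rinv_l by lra. simpl in Hr. lra.
  - apply Rle_lt_trans with ((C + 1) * Rabs h - Rabs h); [lra|].
    assert ((C + 1) * Rabs h < (C + 1) * (eps / (C + 1))) by (apply Rmult_lt_compat_l; lra).
    replace ((C + 1) * (eps / (C + 1))) with eps in H1 by (field; lra). lra.
Qed.

Section Orbit.

Variables f g : R -> R.
Variables T C : R.
Variable q : bool -> R -> R.
Hypothesis T_pos : 0 < T.
Hypothesis C_nonneg : 0 <= C.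
Hypothesis q_arc : arc f g T C q.

Definition extension (i : bool) (t : R) : R := q i (fold T t).

Lemma singular_iff t :
  singular_time (extension true) (extension false) t <-> fold T t = T.
Proof.
  destruct q_arc as [_ [Hpos [H1 [H2 _]]]]. unfold singular_time, extension. split.
  - intros H. destruct (Req_dec (fold T t) T) as [|Hne]; [assumption|].
    pose proof (fold_range T T_pos t). specialize (Hpos (fold T t) ltac:(lra)). lra.
  - intros ->. left. exact H1.
Qed.

(** Up to a translation [c] by a multiple of [2 * T], a nonsingular time lies in
    [(- T, T)], where the model of the arc applies. *)
Lemma nonsingular_model t0 : fold T t0 <> T ->
  exists (c : R) (z v w : bool -> R -> R),
    (- T < t0 < T -> c = 0) /\
    (forall i t, is_derive (z i) t (v i t) /\ is_derive (v i) t (w i t) /\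
        continuous (w i) t) /\ (forall i, v i 0 = 0) /\
    (forall i, locally t0 (fun t => extension i t = z i (t - c))) /\
    w true (t0 - c) = Derive f (extension true t0)
        + Derive g (extension false t0 - extension true t0) /\
    w false (t0 - c) = Derive f (extension false t0)
        - Derive g (extension false t0 - extension true t0) /\
    (0 <= t0 < T -> Rabs (v false t0) <= C * (T - t0)).
Proof.
  intros Hns. destruct (near_multiple T T_pos t0) as [k Hk].
  set (c := IZR k * (2 * T)) in *.
  assert (Hfold : forall t, - T <= t - c <= T -> fold T t = Rabs (t - c)).
  { intros t Ht. replace t with (t - c + c) at 1 by ring.
    unfold c at 2. now rewrite fold_shift, fold_abs by lra. }
  assert (Hlt : Rabs (t0 - c) < T).
  { rewrite <- Hfold by lra. pose proof (fold_range T T_pos t0). lra. }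
  pose proof (Rabs_pos (t0 - c)).
  (* Midway to the collision, so that the model covers a neighbourhood of [t0]. *)
  set (tau := (Rabs (t0 - c) + T) / 2).
  destruct q_arc as [Hmodel _].
  destruct (Hmodel tau ltac:(unfold tau; lra)) as [z [v [w [Hd [Hv0 [Hz [Hw Hv]]]]]]].
  assert (Hloc : forall i t, Rabs (t - c) <= tau -> extension i t = z i (t - c)).
  { intros i t Ht. unfold extension. rewrite Hfold; [now apply Hz|].
    apply Rabs_le_between. unfold tau in Ht. lra. }
  assert (Ht0 : Rabs (t0 - c) <= tau) by (unfold tau; lra).
  assert (Hc : - T < t0 < T -> c = 0).
  { intros Ht. unfold c in *. apply Rabs_def2 in Hlt.
    assert (k = 0%Z) as ->; [|ring].
    assert (-1 < IZR k < 1) as [H1 H2] by (split; nra).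
    apply lt_IZR in H1. apply lt_IZR in H2. lia. }
  exists c, z, v, w. split; [exact Hc|]. split; [exact Hd|]. split; [exact Hv0|].
  split; [|split; [|split]].
  - intros i. assert (Hr : 0 < tau - Rabs (t0 - c)) by (unfold tau; lra).
    exists (mkposreal _ Hr). intros t Ht. apply Hloc.
    unfold ball in Ht; simpl in Ht; unfold AbsRing_ball, abs, minus, plus, opp in Ht; simpl in Ht.
    replace (t - c) with ((t + - t0) + (t0 - c)) by ring.
    eapply Rle_trans; [apply Rabs_triang|]. lra.
  - rewrite !Hloc by exact Ht0. now apply Hw.
  - rewrite !Hloc by exact Ht0. now apply Hw.
  - intros Ht. specialize (Hc ltac:(lra)). apply Hv.
    rewrite Hc, Rminus_0_r, Rabs_right in Ht0 by lra. lra.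
Qed.

Lemma extension_symmetric i t : extension i (2 * T - t) = extension i t.
Proof. unfold extension. now rewrite fold_reflect. Qed.

(** The outer particle is at rest at the collision, so its position is
    stationary to second order. *)
Lemma extension_near_collision k t :
  Rabs (t - (T + IZR k * (2 * T))) <= T ->
  Rabs (extension false t - extension false (T + IZR k * (2 * T)))
    <= C * (t - (T + IZR k * (2 * T))) ^ 2.
Proof.
  intros Ht. destruct q_arc as [_ [_ [_ [_ [_ Hflat]]]]]. unfold extension.
  rewrite (fold_near_odd_multiple T T_pos k t Ht).
  rewrite (fold_near_odd_multiple T T_pos k) by (rewrite Rminus_diag, Rabs_R0; lra).
  set (r := t - _) in *. rewrite Rminus_diag, Rabs_R0, Rminus_0_r.
  pose proof (Rabs_pos r).
  eapply Rle_trans; [apply Hflat; lra|].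
  replace (T - (T - Rabs r)) with (Rabs r) by ring. rewrite pow2_abs. lra.
Qed.

Lemma extension_continuous i t : continuous (extension i) t.
Proof.
  destruct (Req_dec (fold T t) T) as [HT|HT].
  - destruct (fold_eq_T T T_pos t HT) as [k ->].
    set (t0 := T + IZR k * (2 * T)) in *.
    apply continuous_R. intros eps Heps. destruct i.
    + destruct q_arc as [_ [_ [H1 [_ [Hsmall _]]]]].
      destruct (Hsmall eps Heps) as [del [Hdel Hs]].
      exists (Rmin del T). split; [now apply Rmin_glb_lt|]. intros s Hst.
      pose proof (Rmin_l del T). pose proof (Rmin_r del T). pose proof (Rabs_pos (s - t0)).
      unfold extension. rewrite HT, H1, Rminus_0_r.
      rewrite (fold_near_odd_multiple T T_pos k s) by (fold t0; lra).
      fold t0. apply Hs; lra.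
    + assert (Hd : 0 < Rmin (Rmin T 1) (eps / (C + 1))).
      { repeat apply Rmin_glb_lt; try lra. apply Rdiv_lt_0_compat; lra. }
      exists (Rmin (Rmin T 1) (eps / (C + 1))). split; [exact Hd|]. intros s Hst.
      pose proof (Rmin_l (Rmin T 1) (eps / (C + 1))).
      pose proof (Rmin_r (Rmin T 1) (eps / (C + 1))).
      pose proof (Rmin_l T 1). pose proof (Rmin_r T 1).
      eapply Rle_trans; [apply (extension_near_collision k s); fold t0; lra|].
      fold t0. rewrite <- pow2_abs. pose proof (Rabs_pos (s - t0)).
      assert (Rabs (s - t0) ^ 2 <= Rabs (s - t0)) by nra.
      apply Rle_trans with ((C + 1) * (eps / (C + 1))); [|right; field; lra].
      apply Rmult_le_compat; try lra. apply pow2_ge_0.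
  - destruct (nonsingular_model t HT) as [c [z [v [w [_ [Hd [_ [Hl _]]]]]]]].
    eapply is_derive_continuous.
    exact (proj1 (local_model_C2 _ _ _ _ _ _ (Hd i) (Hl i))).
Qed.

(** After the collision the velocity is obtained from that before it by the
    symmetry about [T]. *)
Lemma derivative_near_T t : Rabs (t - T) < T -> t <> T ->
  exists l, is_derive (extension false) t l /\ Rabs l <= C * Rabs (t - T).
Proof.
  intros Ht Hne. apply Rabs_def2 in Ht.
  assert (Hbefore : forall s, 0 < s < T ->
     exists l, is_derive (extension false) s l /\ Rabs l <= C * (T - s)).
  { intros s Hs.
    assert (HT : fold T s <> T) by (rewrite fold_id; lra).
    destruct (nonsingular_model s HT) as [c [z [v [w [Hc [Hd [_ [Hl [_ [_ Hv]]]]]]]]]].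
    exists (v false s). split; [|apply Hv; lra].
    rewrite <- (Rminus_0_r s) at 2. rewrite <- (Hc ltac:(lra)).
    exact (proj1 (local_model_C2 _ _ _ _ _ _ (Hd false) (Hl false))). }
  destruct (Rlt_dec t T) as [Hlt|Hgt].
  - destruct (Hbefore t ltac:(lra)) as [l [H1 H2]]. exists l. split; [exact H1|].
    rewrite (Rabs_left (t - T)) by lra. now replace (- (t - T)) with (T - t) by ring.
  - destruct (Hbefore (2 * T - t) ltac:(lra)) as [l [H1 H2]]. exists (-1 * l). split.
    + apply (is_derive_ext (fun s => extension false (2 * T - s))).
      * intros s. apply extension_symmetric.
      * apply (is_derive_comp (extension false) (fun s => 2 * T - s)); [exact H1|].
        auto_derive; [trivial|ring].
    + rewrite Rabs_mult, Rabs_m1, (Rabs_right (t - T)) by lra.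
      replace (t - T) with (T - (2 * T - t)) by ring. lra.
Qed.

Lemma extension_derive_T : is_derive (extension false) T 0.
Proof.
  apply (is_derive_flat _ T C C_nonneg). exists (mkposreal T T_pos). intros t Ht.
  pose proof (extension_near_collision 0 t) as H.
  rewrite Rmult_0_l, Rplus_0_r in H. apply H.
  left. exact Ht.
Qed.

Lemma extension_C1_T : continuous (Derive (extension false)) T.
Proof.
  apply continuous_R. intros eps Heps.
  assert (0 < eps / (C + 1)) by (apply Rdiv_lt_0_compat; lra).
  exists (Rmin T (eps / (C + 1))). split; [apply Rmin_glb_lt; lra|]. intros s Hs.
  pose proof (Rmin_l T (eps / (C + 1))). pose proof (Rmin_r T (eps / (C + 1))).
  rewrite (is_derive_unique _ _ _ extension_derive_T), Rminus_0_r.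
  destruct (Req_dec s T) as [->|Hne].
  - rewrite (is_derive_unique _ _ _ extension_derive_T), Rabs_R0; lra.
  - destruct (derivative_near_T s ltac:(lra) Hne) as [l [Hl Hle]].
    rewrite (is_derive_unique _ _ _ Hl).
    eapply Rle_trans; [exact Hle|].
    apply Rle_trans with ((C + 1) * (eps / (C + 1))); [|right; field; lra].
    pose proof (Rabs_pos (s - T)). apply Rmult_le_compat; lra.
Qed.

Lemma extension_is_frozen_planet_orbit :
  frozen_planet_orbit f g T (extension true) (extension false).
Proof.
  pose proof q_arc as Harc. destruct Harc as [_ [Hpos [H1 [H2 _]]]].
  assert (Hns : forall t, ~ singular_time (extension true) (extension false) t ->
    fold T t <> T) by (intros t Ht HT; apply Ht; now apply singular_iff).
  assert (Hord : forall t, fold T t <> T -> 0 < extension true t < extension false t).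
  { intros t Ht. apply Hpos. pose proof (fold_range T T_pos t). lra. }
  assert (HC2 : forall i, C2_on (fun t => ~ singular_time (extension true) (extension false) t)
     (extension i)).
  { intros i t Ht.
    destruct (nonsingular_model t (Hns t Ht)) as [c [z [v [w [_ [Hd [_ [Hl _]]]]]]]].
    destruct (local_model_C2 _ _ _ _ _ _ (Hd i) (Hl i)) as [D1 [_ [D2 [D3 _]]]].
    split; [now exists (v i (t - c))|]. now split. }
  assert (HfT : fold T T = T) by (apply fold_id; lra).
  assert (Hvel : forall i, is_derive (extension i) 0 0).
  { intros i. assert (H0 : fold T 0 <> T) by (rewrite fold_id; lra).
    destruct (nonsingular_model 0 H0) as [c [z [v [w [Hc [Hd [Hv0 [Hl _]]]]]]]].
    pose proof (proj1 (local_model_C2 _ _ _ _ _ _ (Hd i) (Hl i))) as D1.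
    now rewrite (Hc ltac:(lra)), Rminus_0_r, Hv0 in D1. }
  split.
  - split.
    + intros t. split; apply extension_continuous.
    + intros t. unfold extension. now rewrite fold_periodic.
    + intros t0 Hs. apply singular_iff in Hs.
      destruct (fold_eq_T T T_pos t0 Hs) as [k ->].
      exists (mkposreal T T_pos). intros t Ht Hne HS. apply singular_iff in HS.
      change (Rabs (t - (T + IZR k * (2 * T))) < T) in Ht.
      rewrite (fold_near_odd_multiple T T_pos k t) in HS by lra.
      apply Hne. apply Rminus_diag_uniq, Rabs_eq_0. lra.
    + apply HC2.
    + apply HC2.
    + intros t Ht. specialize (Hns t Ht). specialize (Hord t Hns).
      destruct (nonsingular_model t Hns) as [c [z [v [w [_ [Hd [_ [Hl [Hw _]]]]]]]]].
      destruct (local_model_C2 _ _ _ _ _ _ (Hd true) (Hl true)) as [_ [_ [_ [_ ->]]]].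
      rewrite !Rabs_right by lra. exact Hw.
    + intros t Ht. specialize (Hns t Ht). specialize (Hord t Hns).
      destruct (nonsingular_model t Hns) as [c [z [v [w [_ [Hd [_ [Hl [_ [Hw _]]]]]]]]]].
      destruct (local_model_C2 _ _ _ _ _ _ (Hd false) (Hl false)) as [_ [_ [_ [_ ->]]]].
      rewrite !Rabs_right by lra. exact Hw.
  - intros t _. split; apply extension_symmetric.
  - intros t Ht. unfold extension. rewrite fold_id by lra.
    destruct (Req_dec t T) as [->|]; [lra|]. apply Hpos; lra.
  - intros t Ht. unfold extension. rewrite fold_id by lra. now apply Hpos.
  - unfold extension. now rewrite HfT.
  - intros t Ht. destruct (Req_dec t T) as [->|Hne].
    + split; [exists 0; exact extension_derive_T|exact extension_C1_T].
    + assert (HT : fold T t <> T) by (rewrite fold_id; lra).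
      destruct (nonsingular_model t HT) as [c [z [v [w [_ [Hd [_ [Hl _]]]]]]]].
      destruct (local_model_C2 _ _ _ _ _ _ (Hd false) (Hl false)) as [D1 [_ [D2 _]]].
      split; [now exists (v false (t - c))|]. now apply @ex_derive_continuous.
  - apply Hvel.
  - apply Hvel.
  - exact extension_derive_T.
  - intros t Ht Hs. apply singular_iff in Hs.
    rewrite fold_near_T in Hs by lra. apply Rminus_diag_uniq, Rabs_eq_0. lra.
Qed.

End Orbit.

Theorem theorem1p1 (f g : R -> R)
  (f_pos : forall s, 0 < s -> 0 < f s)
  (g_pos : forall s, 0 < s -> 0 < g s)
  (f_C2 : C2_on (fun s => 0 < s) f)
  (g_C2 : C2_on (fun s => 0 < s) g)
  (f_singular : filterlim f (at_right 0) (Rbar_locally p_infty))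
  (g_singular : filterlim g (at_right 0) (Rbar_locally p_infty))
  (f_infty : is_lim f p_infty 0)
  (f'_infty : is_lim (Derive f) p_infty 0)
  (g_infty : is_lim g p_infty 0)
  (g'_infty : is_lim (Derive g) p_infty 0)
  (f'_le0 : forall s, 0 < s -> Derive f s <= 0)
  (g'_le0 : forall s, 0 < s -> Derive g s <= 0)
  (f''_ge0 : forall s, 0 < s -> 0 <= Derive_n f 2 s)
  (g''_ge0 : forall s, 0 < s -> 0 <= Derive_n g 2 s)
  (homogeneity : exists alpha, 0 < alpha < 2 /\
    forall s, 0 < s ->
      0 <= s * Derive f s + alpha * f s /\
      s * Derive g s + alpha * g s <= 0)
  (domination : exists s, 0 < s /\ 0 < g s < f s) :
  forall T : R, 0 < T ->
    exists q1 q2 : R -> R, frozen_planet_orbit f g T q1 q2.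
Proof.
  intros T T_pos.
  destruct (truncation_constants_exist f g T) as
    [s0 [d [M [s0_pos [s0_fall [d_pos [d_steep [d_high [M_large M_pull]]]]]]]]]; trivial.
  destruct (arc_exists f g f_C2 g_C2 f'_le0 g'_le0 f''_ge0 g''_ge0 T s0 d M
    T_pos s0_pos s0_fall d_pos d_steep d_high M_large M_pull) as [q Hq].
  exists (extension T q true), (extension T q false).
  apply (extension_is_frozen_planet_orbit f g T (- Derive f s0)); trivial.
  specialize (f'_le0 s0 s0_pos). lra.
Qed.
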